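(* Let $K$ be a field with $\frac16\in K$, and let $H\in K[x]^m$ be cubic homogeneous. Define $r:=\operatorname{rk}\mathcal{J}H$ and suppose that $1\le r\le 2$. Then there are $S\in\operatorname{GL}_m(K)$ and $T\in\operatorname{GL}_n(K)$ such that for $\tilde H:=S\,H(Tx)$, one of the following holds: (1) only the first $r$ rows of $\mathcal{J}\tilde H$ are nonzero (all other rows are zero); (2) $r=2$ and only the first $2$ columns of $\mathcal{J}\tilde H$ are nonzero (all other columns are zero); (3) $r=2$ and $K\tilde H_1+K\tilde H_2+\cdots+K\tilde H_m=Kx_3x_1^2\oplus Kx_3x_1x_2\oplus Kx_3x_2^2$. Furthermore, if $m=n$, we can take $S=T^{-1}$.
   Context: $n,m$ are positive integers and $x=(x_1,\dots,x_n)$ is an $n$-tuple of variables (viewed as a column vector in matrix products). For $H=(H_1,\dots,H_m)\in K[x]^m$, $\mathcal{J}H=(\partial H_i/\partial x_j)_{i,j}$ is the $m\times n$ Jacobian matrix, and $\operatorname{rk}$ is its rank over $K(x)$. $H(Tx)$ denotes substitution of the vector $Tx$ for $x$. Cubic homogeneous means that every nonzero component is a homogeneous polynomial of degree $3$. $\frac16\in K$ means that the characteristic of $K$ is neither $2$ nor $3$. *)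

(* Defs.v *)
From mathcomp Require Import all_boot all_order all_algebra.
From mathcomp Require Import fraction.
From mathcomp.multinomials Require Import mpoly.

Set Implicit Arguments.
Unset Strict Implicit.
Unset Printing Implicit Defensive.

Import GRing.Theory.
Local Open Scope ring_scope.

Definition mpoly_jacobian (K : fieldType) (m n : nat)
    (H : 'cV[{mpoly K[n]}]_m) : 'M[{mpoly K[n]}]_(m, n) :=
  \matrix_(i < m, j < n) (H i 0)^`M(j).

Definition mpoly_rank (K : fieldType) (m n p : nat)
    (A : 'M[{mpoly K[n]}]_(m, p)) : nat :=
  \rank (map_mx (@FracField.tofrac {mpoly K[n]}) A).

(* The zero polynomial is d.-homog for every d, so zero components are
   allowed. *)
Definition cubic_homogeneous (K : fieldType) (m n : nat)
    (H : 'cV[{mpoly K[n]}]_m) : Prop :=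
  forall i : 'I_m, H i 0 \is 3.-homog.

Definition const_mpoly_mx (K : fieldType) (n m p : nat)
    (A : 'M[K]_(m, p)) : 'M[{mpoly K[n]}]_(m, p) :=
  map_mx (fun c : K => c%:MP) A.

(* S H(Tx) *)
Definition linear_change (K : fieldType) (m n : nat) (S : 'M[K]_m)
    (T : 'M[K]_n) (H : 'cV[{mpoly K[n]}]_m) : 'cV[{mpoly K[n]}]_m :=
  let Tx := const_mpoly_mx n T *m (\col_(j < n) 'X_j) in
  const_mpoly_mx n S *m
    map_mx (fun p => p \mPo [tuple Tx i 0 | i < n]) H.

Definition in_span (K : fieldType) (V : lmodType K) (k : nat)
    (v : 'I_k -> V) (p : V) : Prop :=
  exists c : 'I_k -> K, p = \sum_(i < k) c i *: v i.

Definition lin_indep (K : fieldType) (V : lmodType K) (k : nat)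
    (v : 'I_k -> V) : Prop :=
  forall c : 'I_k -> K, \sum_(i < k) c i *: v i = 0 -> forall i, c i = 0.

(* K H_1 + ... + K H_m = K x3 x1^2 (+) K x3 x1 x2 (+) K x3 x2^2, where
   x1, x2, x3 are the variables with 0-based indices 0, 1, 2; in particular
   n >= 3. *)
Definition span_x3_quadrics (K : fieldType) (m n : nat)
    (H : 'cV[{mpoly K[n]}]_m) : Prop :=
  exists i1 i2 i3 : 'I_n,
    [/\ i1 = 0%N :> nat, i2 = 1%N :> nat & i3 = 2%N :> nat] /\
    let x1 : {mpoly K[n]} := 'X_i1 in
    let x2 : {mpoly K[n]} := 'X_i2 in
    let x3 : {mpoly K[n]} := 'X_i3 in
    let b := tnth [tuple x3 * x1 ^+ 2; x3 * x1 * x2; x3 * x2 ^+ 2] in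
    lin_indep b /\
    (forall p, in_span (fun i : 'I_m => H i 0) p <-> in_span b p).

(* Main.v *)
Require Import Defs.
From mathcomp Require Import all_boot all_order all_algebra.
From mathcomp Require Import fraction.
From mathcomp.multinomials Require Import mpoly.
From mathcomp Require Import ring.
Import GRing.Theory.
Local Open Scope ring_scope.

Set Implicit Arguments.
Unset Strict Implicit.
Unset Printing Implicit Defensive.

(** Normalizing at a generic point.  As [#|K| >= 5] and the [r]-minors of [JH]
have degree at most 4, [JH] has rank [r] at some point [a] of [K^n].  Move [a]
to the first unit vector and bring [JH(a)] to normal form; for [r = 2] and
[H(a) <> 0] this gives, in powers of [x1],
  [F1 = x1^3 + x1 q1 + c1],  [F2 = x1^2 x2 + x1 q2 + c2],  [Fk = x1 qk + ck],
with [q], [c] free of [x1].  Contracting the vanishing 3-minors with Euler's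
identity and reading off the coefficients of [x1^6] and [x1^5] gives
[Fk = ak (x1 x2^2 + 2 x2 q2) + bk x2^3].  If all [Fk] vanish, case (1) holds; if
[x2^3] occurs in their span, everything lies in [K[x1, x2]].  Otherwise the [Fk]
span a line [K G]; the coefficients of [x1^4] and [x1^3] then force
  [F1 = p^2 g + 2 p u + d x2^3],  [F2 = x2 (p g + u)],  [G = x2^2 g]
with [p = x1 - l] and [g = x1 + 2 l], up to multiples of [G], and the last two
coefficients leave only [u = d = 0] with [p], [x2], [g] independent (case (3)) or
[l] and [u] in [K[x2]] (case (2)).  When [r = 1] or [H(a) = 0] the same expansion
gives [Fk = 0] for [k > r].  Case (1) only involves [S], cases (2) and (3) only
[T], so [S = T^-1] can be arranged when [m = n]. *)

(** * Chain rule, Euler's identity and specialization of one variable *)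

Section Polynomials.
Variables (K : fieldType) (n : nat).
Implicit Types (p q f : {mpoly K[n]}) (i j : 'I_n).

(** Suited to substitutions and derivations, which are determined by their effect on constants and
    variables. *)
Lemma mpoly_ring_ind (P : {mpoly K[n]} -> Prop) :
  (forall c, P c%:MP) -> (forall i, P 'X_i) ->
  (forall p q, P p -> P q -> P (p + q)) ->
  (forall p q, P p -> P q -> P (p * q)) -> forall p, P p.
Proof.
move=> PC PX PD PM; have PE k p : P p -> P (p ^+ k).
  by move=> Pp; elim: k => [|k IH]; rewrite ?expr0 -?mpolyC1 // exprS; apply: (PM).
apply: mpolyind => [|c m p _ _ Pp]; first by rewrite -mpolyC0.
apply: (PD) => //; rewrite -mul_mpolyC; apply: (PM) => //; rewrite mpolyXE_id.
by elim/big_rec: _ => [|i q _ Pq]; [rewrite -mpolyC1 | apply: (PM) => //; apply: (PE)].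
Qed.

Lemma mderivXU i j : ('X_i : {mpoly K[n]})^`M(j) = (i == j)%:R.
Proof.
rewrite mderivX mnm1E; case: eqP => [->|_]; last by rewrite scale0r.
by rewrite -[X in (X - _)%MM]add0m addmK mpolyX0 scale1r.
Qed.

Lemma mderiv_nat k i : (k%:R : {mpoly K[n]})^`M(i) = 0.
Proof. by rewrite -(rmorph_nat (@mpolyC n K)) mderivC. Qed.

Lemma mderiv1 i : (1 : {mpoly K[n]})^`M(i) = 0.
Proof. exact: (mderiv_nat 1). Qed.

Definition mderivE := (mderiv0, mderiv1, mderivN, mderivD, mderivB, mderivM,
  mderiv_nat, mderivC).

Lemma mderiv_comp (k : nat) (lq : n.-tuple {mpoly K[k]}) p (j : 'I_k) :
  (p \mPo lq)^`M(j) = \sum_(i < n) (p^`M(i) \mPo lq) * (tnth lq i)^`M(j).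
Proof.
elim/mpoly_ring_ind: p => [c|i0|p q IHp IHq|p q IHp IHq].
- by rewrite comp_mpolyC mderivC big1 // => i _; rewrite mderivC raddf0 mul0r.
- rewrite comp_mpolyXU (bigD1 i0) //= mderivXU eqxx rmorph1 mul1r -tnth_nth.
  rewrite big1 ?addr0 // => i ne_i.
  by rewrite mderivXU eq_sym (negPf ne_i) rmorph0 mul0r.
- rewrite !raddfD /= IHp IHq -big_split; apply: eq_bigr => i _.
  by rewrite mderivD raddfD mulrDl.
- rewrite rmorphM mderivM /= IHp IHq mulr_suml mulr_sumr -big_split /=.
  by apply: eq_bigr => i _; rewrite mderivM rmorphD !rmorphM /=; ring.
Qed.

Lemma comp_mpoly_comp (k l : nat) (lq : n.-tuple {mpoly K[k]})
    (lr : k.-tuple {mpoly K[l]}) p :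
  (p \mPo lq) \mPo lr = p \mPo [tuple tnth lq i \mPo lr | i < n].
Proof.
elim/mpoly_ring_ind: p => [c|i|p q IHp IHq|p q IHp IHq].
- by rewrite !comp_mpolyC.
- by rewrite !comp_mpolyXU -!tnth_nth tnth_mktuple.
- by rewrite !raddfD /= IHp IHq.
- by rewrite !rmorphM /= IHp IHq.
Qed.

(** Checked on monomials: ['X_i] times the derivative along ['X_i] multiplies a monomial by its
    exponent in ['X_i]. *)
Lemma euler d p : p \is d.-homog -> \sum_i 'X_i * p^`M(i) = d%:R *: p.
Proof.
move=> /dhomogP hp; pose D q : {mpoly K[n]} := \sum_i 'X_i * q^`M(i).
have -> : \sum_i 'X_i * p^`M(i) = \sum_(m <- msupp p) D (p@_m *: 'X_[m]).
  rewrite exchange_big; apply: eq_bigr => i _.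
  by rewrite {1}[p]mpolyE raddf_sum mulr_sumr.
rewrite [p in RHS]mpolyE scaler_sumr !big_seq; apply: eq_bigr => m /hp /= <-.
rewrite mdegE natr_sum scaler_suml; apply: eq_bigr => i _.
rewrite mderivZ mderivX -!scalerAr.
(* Exponent zero is treated apart because subtraction of exponents is truncated. *)
case: (posnP (m i)) => [->|mi]; first by rewrite !scale0r scaler0.
rewrite -mpolyXD addmC submK; first by rewrite scalerA mulrC -scalerA.
by rewrite lep1mP -lt0n.
Qed.

Lemma mderiv_homog d p i : p \is d.+1.-homog -> p^`M(i) \is d.-homog.
Proof.
move=> /dhomogP hp; apply/dhomogP => m.
rewrite mcoeff_msupp mcoeff_mderiv => nz.
suff /hp hm : (m + U_(i))%MM \in msupp p.
  by have : mdeg (m + U_(i)) = d.+1 := hm; rewrite mdegD mdeg1 addn1 => -[].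
by rewrite mcoeff_msupp; apply: contra_neq nz => ->; rewrite mul0rn.
Qed.

Lemma homogX i : 'X_i \is [in K[n], 1.-homog].
Proof. by rewrite dhomogX; apply/eqP; exact: mdeg1. Qed.

Lemma homog0_const p : p \is 0.-homog -> exists c, p = c%:MP.
Proof.
move=> /dhomogP hp; exists p@_0; apply: msize1_polyC.
by rewrite msizeE; apply/bigmax_leqP_seq => m /hp /= ->.
Qed.

Definition subst_var i (c : K) : n.-tuple {mpoly K[n]} :=
  [tuple if j == i then c%:MP else 'X_j | j < n].

Lemma subst_varX i c j :
  'X_j \mPo subst_var i c = if j == i then c%:MP else 'X_j.
Proof. by rewrite comp_mpolyXU -tnth_nth tnth_mktuple. Qed.

(** Congruence modulo ['X_i - c] is compatible with sums and products, so only constants and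
    variables need checking. *)
Lemma subst_var_divides i c p :
  exists p', p = (p \mPo subst_var i c) + ('X_i - c%:MP) * p'.
Proof.
elim/mpoly_ring_ind: p => [a|j|p q [p' ep] [q' eq]|p q [p' ep] [q' eq]].
- by exists 0; rewrite comp_mpolyC mulr0 addr0.
- rewrite subst_varX; case: eqP => [->|_]; last by exists 0; rewrite mulr0 addr0.
  by exists 1; ring.
- by exists (p' + q'); rewrite {1}ep {1}eq rmorphD; ring.
- set s := subst_var i c in ep eq *.
  exists (p' * (q \mPo s) + (p \mPo s) * q' + ('X_i - c%:MP) * p' * q').
  by rewrite {1}ep {1}eq rmorphM /=; ring.
Qed.

(** [msize] is the total degree plus one, and 0 for the zero polynomial; bounds by a successor are
    degree bounds that include zero. *)
Lemma msizeM_leS f g k1 k2 :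
  (msize f <= k1.+1 -> msize g <= k2.+1 -> msize (f * g) <= (k1 + k2).+1)%N.
Proof.
have [->|f0] := eqVneq f 0; first by rewrite mul0r msize0.
have [->|g0] := eqVneq g 0; first by rewrite mulr0 msize0.
move=> hf hg; rewrite msizeM //; move: (leq_add hf hg).
by rewrite addSn addnS; case: (msize f + msize g)%N.
Qed.

Lemma msize_subst_var i c p : (msize (p \mPo subst_var i c) <= msize p)%N.
Proof.
rewrite comp_mpolyEX; apply: leq_trans (msize_sum _ _ _) _.
apply/bigmax_leqP_seq => m mp _; apply: leq_trans (msizeZ_le _ _) _.
apply: leq_trans (msize_mdeg_lt mp); rewrite comp_mpolyX mdegE.
elim/big_rec2: _ => [|j k q _ le_qk]; first by rewrite msize1.
rewrite tnth_mktuple.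
apply: msizeM_leS => //.
elim: (m j) => [|e IHe]; first by rewrite expr0 msize1.
rewrite exprS -[e.+1]add1n; apply: msizeM_leS => //.
by case: ifP => _; [rewrite msizeC; case: eqP | rewrite msizeX mdeg1].
Qed.

End Polynomials.

(** * Points at which a polynomial of small degree does not vanish *)

Section NonVanishing.
Variables (K : fieldType) (n : nat).
Implicit Types (p : {mpoly K[n]}) (s : seq K).

(** An element [c] of [s] splits off a factor ['X_i - c], which lowers the degree by one; the other
    elements of [s] remain roots of the quotient. *)
Lemma subst_var_roots i s p :
    uniq s -> (forall c, c \in s -> p \mPo subst_var i c = 0) ->
  (msize p <= size s)%N -> p = 0.
Proof.
elim: s p => [|c s IH] p /=.
  by rewrite leqn0 msize_poly_eq0 => _ _ /eqP.
case/andP=> c_s uniq_s roots_p szp.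
have [p' ep] := subst_var_divides i c p.
rewrite roots_p ?mem_head // add0r in ep.
have X_c d : ('X_i - c%:MP) \mPo subst_var i d = (d - c)%:MP :> {mpoly K[n]}.
  by rewrite rmorphB /= subst_varX eqxx comp_mpolyC mpolyCB.
suff p'0 : p' = 0 by rewrite ep p'0 mulr0.
apply: IH => // [d d_s|].
  have /eqP : p \mPo subst_var i d = 0 by apply: roots_p; rewrite inE d_s orbT.
  rewrite ep rmorphM /= X_c mulf_eq0 mpolyC_eq0 subr_eq0 => /orP[/eqP ed|/eqP //].
  by rewrite -ed d_s in c_s.
have [->|p'0] := eqVneq p' 0; first by rewrite msize0.
have Xc0 : 'X_i - c%:MP != 0 :> {mpoly K[n]}.
  apply: contra_eq_neq (X_c (c + 1)) => ->.
  by rewrite rmorph0 eq_sym mpolyC_eq0 addrAC subrr add0r oner_neq0.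
have := szp; rewrite ep msizeM //.
(* A constant would take equal values at ['X_i = c] and ['X_i = c + 1], but here these are 0 and
   1. *)
have : (1 < msize ('X_i - c%:MP : {mpoly K[n]}))%N.
  rewrite ltnNge; apply/negP => /msize1_polyC e.
  have := X_c (c + 1); have := X_c c; rewrite e !comp_mpolyC => -> /eqP.
  by rewrite -subr_eq0 -mpolyCB mpolyC_eq0 subrr addrAC subrr !add0r oppr_eq0 oner_eq0.
by case: (msize _) => [|[|k]] //= _; rewrite addSn /= => /(leq_trans (leq_addl _ _)).
Qed.

Lemma comp_mpoly_const (lq : n.-tuple {mpoly K[n]}) (v : 'I_n -> K) p :
  (forall i, tnth lq i = (v i)%:MP) -> p \mPo lq = (p.@[v])%:MP.
Proof.
move=> hv; elim/mpoly_ring_ind: p => [c|i|p q IHp IHq|p q IHp IHq].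
- by rewrite comp_mpolyC mevalC.
- by rewrite comp_mpolyXU -tnth_nth hv mevalXU.
- by rewrite !raddfD /= IHp IHq.
- by rewrite !rmorphM /= IHp IHq.
Qed.

(** The variables are specialized one by one to elements of [s]. The degree never grows and stays
    below the size of [s], so some element always keeps the polynomial nonzero. *)
Lemma mpoly_nonzero_point s p :
  uniq s -> p != 0 -> (msize p <= size s)%N -> exists v, p.@[v] != 0.
Proof.
move=> uniq_s p0 szp.
(* Invariant, by induction on the list of treated variables: each entry is a constant or an
   untreated variable. For the full list [enum 'I_n] only constants are left. *)
have [lq [lq0 _ lqC]] : exists lq : n.-tuple {mpoly K[n]},
    [/\ p \mPo lq != 0, (msize (p \mPo lq) <= size s)%N
      & forall i, (exists c, tnth lq i = c%:MP)
                  \/ tnth lq i = 'X_i /\ i \notin enum 'I_n].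
  elim: (enum 'I_n) => [|i l [lq [lq0 szlq lqC]]].
    exists [tuple 'X_i | i < n]; rewrite comp_mpoly_id; split=> // i.
    by right; rewrite tnth_mktuple.
  have [c hc] : exists c, (p \mPo lq) \mPo subst_var i c != 0.
    have [/hasP[c _ hc]|/hasPn h] :=
      boolP (has (fun c => (p \mPo lq) \mPo subst_var i c != 0) s).
      by exists c.
    move: lq0; rewrite (@subst_var_roots i s (p \mPo lq)) ?eqxx // => c /h.
    by rewrite negbK => /eqP.
  exists [tuple tnth lq j \mPo subst_var i c | j < n].
  rewrite -comp_mpoly_comp; split=> // [|j].
    exact: leq_trans (msize_subst_var _ _ _) szlq.
  rewrite inE tnth_mktuple; case: (lqC j) => [[d ->]|[-> j_l]].
    by left; exists d; rewrite comp_mpolyC.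
  rewrite subst_varX (negPf j_l) orbF; case: eqP => [_|_]; first by left; exists c.
  by right.
have [v hv] : exists v : 'I_n -> K, forall i, tnth lq i = (v i)%:MP.
  exists (fun i => (tnth lq i)@_0) => i.
  by case: (lqC i) => [[c ->]|[_]]; rewrite ?mcoeffC ?eqxx ?mulr1 ?mem_enum.
by exists v; rewrite (comp_mpoly_const _ hv) mpolyC_eq0 in lq0.
Qed.

Lemma natr_small_neq0 d : 2%N \notin [pchar K] -> 3%N \notin [pchar K] ->
  (0 < d < 5)%N -> d%:R != 0 :> K.
Proof.
move=> c2 c3; have h2 : 2%:R != 0 :> K by move: c2; rewrite inE /=.
have h3 : 3%:R != 0 :> K by move: c3; rewrite inE /=.
case: d => [|[|[|[|[|d]]]]] // _; rewrite ?oner_eq0 //.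
by rewrite (natrM _ 2 2) mulf_neq0.
Qed.

(** The images of 0, ..., 4 in [K] are distinct, since 1, ..., 4 are nonzero there; five values
    suffice for degree at most 4. *)
Lemma mpoly_degree4_nonzero_point p :
  2%N \notin [pchar K] -> 3%N \notin [pchar K] ->
  p != 0 -> (msize p <= 5)%N -> exists v, p.@[v] != 0.
Proof.
move=> c2 c3 p0 szp; have neq d := natr_small_neq0 (d := d) c2 c3.
apply: (@mpoly_nonzero_point [seq i%:R | i <- iota 0 5]) => //.
rewrite map_inj_in_uniq ?iota_uniq // => i j; rewrite !mem_iota /=.
wlog le_ij : i j / (i <= j)%N => [h i5 j5 e|i5 j5 /eqP].
  by case/orP: (leq_total i j) => le_ij; [apply: h | symmetry; apply: h].
rewrite eq_sym -subr_eq0 -natrB // => /eqP e; apply/eqP.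
rewrite eqn_leq le_ij -subn_eq0; apply: contraTT isT => ne0.
by move: (neq (j - i)%N); rewrite e eqxx lt0n ne0 (leq_ltn_trans (leq_subr _ _) j5) => /(_ isT).
Qed.

End NonVanishing.

(** * Rank in terms of minors *)

Section Minors.

(** The index maps are arbitrary; a repeated index just gives determinant zero. For existence, [k]
    independent rows are chosen first, then [k] independent columns of the resulting matrix. *)
Lemma rank_minor (F : fieldType) (m n k : nat) (A : 'M[F]_(m, n)) :
  reflect (exists f g, \det (mxsub f g A : 'M_k) != 0) (k <= \rank A)%N.
Proof.
have unitE (B : 'M[F]_k) : (\det B != 0) = (\rank B == k).
  by rewrite -unitfE -unitmxE -row_free_unit.
apply: (iffP idP) => [le_k|[f [g]]]; last first.
  rewrite unitE => /eqP rkB; rewrite -[X in (X <= _)%N]rkB.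
  have -> : mxsub f g A = rowsub f (colsub g A) by apply/matrixP=> i j; rewrite !mxE.
  apply: leq_trans (mxrankS (rowsub_sub _ _)) _.
  by rewrite -mxrank_tr trmx_mxsub -[X in (_ <= X)%N]mxrank_tr mxrankS ?rowsub_sub.
have fullsub p q (B : 'M[F]_(p, q)) : (k <= \rank B)%N ->
    exists f : 'I_k -> 'I_p, \rank (rowsub f B) = k.
  move=> leB; exists (maxrankfun B \o widen_ord leB).
  have /row_freeP[C BC] := maxrowsub_free B.
  apply/eqP; apply/row_freeP; exists (C *m colsub (widen_ord leB) 1%:M).
  rewrite mulmxA; have -> : rowsub (maxrankfun B \o widen_ord leB) B =
    rowsub (widen_ord leB) (rowsub (maxrankfun B) B) by apply/matrixP=> i j; rewrite !mxE.
  rewrite mul_rowsub_mx BC; apply/matrixP=> i j; rewrite -rowsubE !mxE.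
  by rewrite -val_eqE.
have [f rkf] := fullsub _ _ A le_k.
have [|g rkg] := fullsub _ _ (rowsub f A)^T; first by rewrite mxrank_tr rkf.
exists f, g; rewrite unitE -mxrank_tr trmx_mxsub.
have -> : mxsub g f A^T = rowsub g (rowsub f A)^T by apply/matrixP=> i j; rewrite !mxE.
by rewrite rkg.
Qed.

(** Determinants commute with the embedding into the fraction field, so the rank over the fractions
    is governed by minors over [R] itself. *)
Lemma tofrac_rank_minor (R : idomainType) (m n k : nat) (A : 'M[R]_(m, n)) :
  reflect (exists f g, \det (mxsub f g A : 'M_k) != 0)
    (k <= \rank (map_mx (@FracField.tofrac R) A))%N.
Proof.
apply: (iffP (rank_minor _ _)) => -[f [g hfg]]; exists f, g; move: hfg;
by rewrite -map_mxsub det_map_mx tofrac_eq0.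
Qed.

Lemma det_mxsub2 (R : comPzRingType) (m n : nat) (A : 'M[R]_(m, n)) i j u v :
  \det (mxsub (tnth [tuple i; j]) (tnth [tuple u; v]) A)
  = A i u * A j v - A i v * A j u.
Proof.
rewrite (expand_det_row _ 0) !big_ord_recl big_ord0 /cofactor !det_mx11 !mxE.
by rewrite !(tnth_nth i) !(tnth_nth u) /=; ring.
Qed.

Lemma det_mxsub3 (R : comPzRingType) (m n : nat) (A : 'M[R]_(m, n)) i j k u v w :
  \det (mxsub (tnth [tuple i; j; k]) (tnth [tuple u; v; w]) A)
  = A i u * (A j v * A k w - A j w * A k v)
    - A i v * (A j u * A k w - A j w * A k u)
    + A i w * (A j u * A k v - A j v * A k u).
Proof.
rewrite (expand_det_row _ 0) !big_ord_recl big_ord0 /cofactor.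
rewrite !(expand_det_row _ 0) !big_ord_recl !big_ord0 /cofactor !det_mx11 !mxE.
by rewrite !(tnth_nth i) !(tnth_nth u) /=; ring.
Qed.

End Minors.

(** * Expansion in powers of one variable *)

Section FreeOf.
Variables (K : fieldType) (n : nat) (i : 'I_n).
Implicit Types (p q l c : {mpoly K[n]}).

Local Notation X := ('X_i : {mpoly K[n]}).

(* Testing invariance under [X_i := 0] rather than [p^`M(i) = 0]: the latter also
   holds for ['X_i ^+ p] in characteristic [p], and minors reach degree 6 in ['X_i]. *)
Definition free_of p := p \mPo subst_var i 0 == p.

Lemma free_ofD p q : free_of p -> free_of q -> free_of (p + q).
Proof. by move=> /eqP hp /eqP hq; rewrite /free_of rmorphD /= hp hq. Qed.

Lemma free_ofN p : free_of p -> free_of (- p).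
Proof. by move=> /eqP hp; rewrite /free_of rmorphN /= hp. Qed.

Lemma free_ofM p q : free_of p -> free_of q -> free_of (p * q).
Proof. by move=> /eqP hp /eqP hq; rewrite /free_of rmorphM /= hp hq. Qed.

Lemma free_ofXn p k : free_of p -> free_of (p ^+ k).
Proof. by move=> /eqP hp; rewrite /free_of rmorphXn /= hp. Qed.

Lemma free_of_nat k : free_of k%:R.
Proof. by rewrite /free_of rmorph_nat. Qed.

Lemma free_of0 : free_of 0.
Proof. exact: (free_of_nat 0). Qed.

Lemma free_of1 : free_of 1.
Proof. exact: (free_of_nat 1). Qed.

Lemma free_ofMn p k : free_of p -> free_of (p *+ k).
Proof. by move=> /eqP hp; rewrite /free_of rmorphMn /= hp. Qed.

Lemma free_ofC a : free_of a%:MP.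
Proof. by rewrite /free_of comp_mpolyC. Qed.

Lemma free_ofX j : j != i -> free_of 'X_j.
Proof. by move=> /negPf ne_j; rewrite /free_of subst_varX ne_j. Qed.

Lemma free_of_subst p : free_of (p \mPo subst_var i 0).
Proof.
rewrite /free_of comp_mpoly_comp; apply/eqP; congr comp_mpoly.
apply: eq_from_tnth => j; rewrite !tnth_mktuple.
by case: eqP => [|/eqP/negPf ne_j]; rewrite ?comp_mpolyC // subst_varX ne_j.
Qed.

Lemma mderiv_subst p j : (p \mPo subst_var i 0)^`M(j) =
  if j == i then 0 else p^`M(j) \mPo subst_var i 0.
Proof.
rewrite mderiv_comp (bigD1 j) //= big1 ?addr0 => [|k /negPf ne_k].
  by rewrite tnth_mktuple; case: eqP => _;
    rewrite ?mderivC ?mulr0 // mderivXU eqxx mulr1.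
by rewrite tnth_mktuple; case: eqP => _; rewrite ?mderivC ?mderivXU ?ne_k mulr0.
Qed.

Lemma free_of_deriv0 p : free_of p -> p^`M(i) = 0.
Proof. by move=> /eqP <-; rewrite mderiv_subst eqxx. Qed.

Lemma free_of_deriv p j : free_of p -> free_of p^`M(j).
Proof.
move=> /eqP <-; rewrite mderiv_subst; case: eqP => _; last exact: free_of_subst.
exact: free_of0.
Qed.

Lemma free_of_cons p q : free_of p -> p + X * q = 0 -> p = 0 /\ q = 0.
Proof.
move=> /eqP hp e; have p0 : p = 0.
  have := congr1 (comp_mpoly (subst_var i 0)) e.
  by rewrite rmorphD rmorphM /= subst_varX eqxx mpolyC0 mul0r addr0 hp rmorph0.
split=> //; move/eqP: e; rewrite p0 add0r mulf_eq0 => /orP[/eqP X0|/eqP //].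
by move: (msizeX K (U_(i))%MM); rewrite X0 msize0.
Qed.

(** Setting [X := 0] isolates the first coefficient, after which [X] is cancelled. All later
    comparisons of coefficients rest on this; past the end of [s] the default of [nth] is 0. *)
Lemma free_of_horner (s : seq {mpoly K[n]}) : all free_of s ->
  foldr (fun p q => p + X * q) 0 s = 0 -> forall k, s`_k = 0.
Proof.
elim: s => [_ _ k|p s IH /= /andP[hp hs] e k]; first by rewrite nth_nil.
by have [p0 /(IH hs) s0] := free_of_cons hp e; case: k.
Qed.

Lemma homog_divX d p : X * p \is d.+1.-homog -> p \is d.-homog.
Proof.
move=> /dhomogP hp; apply/dhomogP => m hm.
suff hm' : (U_(i) + m)%MM \in msupp (X * p).
  have e : mdeg (U_(i) + m) = d.+1 by exact: hp.
  by move: e; rewrite mdegD mdeg1 add1n => -[].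
by rewrite mcoeff_msupp mulrC mcoeffMX -mcoeff_msupp.
Qed.

Lemma homog_comp k d (lq : n.-tuple {mpoly K[k]}) p :
    (forall j, tnth lq j \is 1.-homog) -> p \is d.-homog ->
  p \mPo lq \is d.-homog.
Proof.
move=> hl /dhomogP hp; rewrite comp_mpolyEX big_seq; apply: rpred_sum => m /hp hm.
have {hm} -> : d = mdeg m by rewrite -hm.
apply: rpredZ; rewrite comp_mpolyX mdegE.
elim/big_rec2: _ => [|j e q _ hq]; first exact: dhomog1.
by apply: dhomogM => //; have := dhomogMn (m j) (hl j); rewrite mul1n.
Qed.

Lemma homog_split d p : p \is d.+1.-homog ->
  exists p', [/\ p = (p \mPo subst_var i 0) + X * p', p' \is d.-homog
               & p \mPo subst_var i 0 \is d.+1.-homog].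
Proof.
move=> hp; have [p' e] := subst_var_divides i 0 p.
rewrite subr0 in e.
have hs : p \mPo subst_var i 0 \is d.+1.-homog.
  apply: homog_comp hp => j; rewrite tnth_mktuple.
  by case: eqP => _; [rewrite mpolyC0 rpred0 | apply: homogX].
exists p'; split=> //; apply: homog_divX.
have -> : X * p' = p - (p \mPo subst_var i 0) by rewrite {1}e addrC addKr.
exact: rpredB.
Qed.

(** For a cubic form the coefficients [h], [l], [q], [c] have degrees 0, 1, 2, 3. Homogeneity and
    freeness are stated separately, so that derivatives can have the same shape. *)
Definition cubic_in (h : K) l q c := h%:MP * X ^+ 3 + X ^+ 2 * l + X * q + c.

Lemma cubic_inP p : p \is 3.-homog -> exists h l q c,
  [/\ p = cubic_in h l q c, l \is 1.-homog, q \is 2.-homog & c \is 3.-homog]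
  /\ [/\ free_of l, free_of q & free_of c].
Proof.
move=> /homog_split[p1 [e0 /homog_split[p2 [e1 /homog_split[p3 [e2 h3 hl]] hq]] hc]].
have [h e3] := homog0_const h3; pose s := subst_var i (0 : K).
exists h, (p2 \mPo s), (p1 \mPo s), (p \mPo s).
split; last by split; apply: free_of_subst.
by split=> //; rewrite /cubic_in {1}e0 {1}e1 {1}e2 e3 -/s; ring.
Qed.

Section CubicDerivatives.
Variables (h : K) (l q c : {mpoly K[n]}).
Hypotheses (fl : free_of l) (fq : free_of q) (fc : free_of c).

Lemma mderiv_cubic_in j : j != i ->
  (cubic_in h l q c)^`M(j) = cubic_in 0 l^`M(j) q^`M(j) c^`M(j).
Proof.
move=> /negPf ne_j; rewrite /cubic_in !exprS expr0 mulr1.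
by rewrite !mderivD !mderivM mderivC mderivXU [i == j]eq_sym ne_j mpolyC0 /=; ring.
Qed.

Lemma mderiv_cubic_in_lead :
  (cubic_in h l q c)^`M(i) = 3%:R * h%:MP * X ^+ 2 + 2%:R * X * l + q.
Proof.
rewrite /cubic_in !exprS expr0 mulr1.
rewrite !mderivD !mderivM mderivC mderivXU eqxx !free_of_deriv0 //=.
by ring.
Qed.

End CubicDerivatives.

(** By induction the derivative along ['X_j] is a multiple of a power of ['X_j], and Euler's
    identity recovers [p] from it after division by the degree. *)
Lemma homog_power j d p :
    (forall k, (0 < k <= d)%N -> k%:R != 0 :> K) -> p \is d.-homog ->
    (forall k, k != j -> p^`M(k) = 0) -> exists a, p = a%:MP * 'X_j ^+ d.
Proof.
elim: d p => [|d IH] p nz hp dp.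
  by have [a ->] := homog0_const hp; exists a; rewrite mulr1.
have := euler hp; rewrite (bigD1 j) //= big1 ?addr0 => [|k /dp ->]; last exact: mulr0.
have [||k ne_k|a ->] := IH p^`M(j).
- by move=> k /andP[k0 kd]; apply: nz; rewrite k0 leqW.
- exact: mderiv_homog.
- by rewrite mderiv_comm dp // mderiv0.
move=> e; exists (d.+1%:R^-1 * a); have hd : d.+1%:R != 0 :> K by apply: nz => /=.
apply: (scalerI hd); rewrite -e -mul_mpolyC [RHS]mulrA -mpolyCM [d.+1%:R * _]mulrA mulfV // mul1r.
by rewrite exprS; ring.
Qed.

Lemma homog_deriv0 d p : d%:R != 0 :> K -> p \is d.-homog ->
  (forall k, p^`M(k) = 0) -> p = 0.
Proof.
move=> nz hp dp; have := euler hp; rewrite big1 => [/esym/eqP|k _]; last by rewrite dp mulr0.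
by rewrite -mul_mpolyC mulf_eq0 mpolyC_eq0 (negPf nz) => /eqP.
Qed.

End FreeOf.

Ltac free_tac := repeat match goal with
  | |- is_true (all _ _) => rewrite /=
  | |- is_true (_ && _) => apply/andP; split
  | |- is_true (free_of _ 0) => exact: free_of0
  | |- is_true (free_of _ 1) => exact: free_of1
  | |- is_true (free_of _ (_ + _)) => apply: free_ofD
  | |- is_true (free_of _ (- _)) => apply: free_ofN
  | |- is_true (free_of _ (_ * _)) => apply: free_ofM
  | |- is_true (free_of _ (_ ^+ _)) => apply: free_ofXn
  | |- is_true (free_of _ (_ *+ _)) => apply: free_ofMn
  | |- is_true (free_of _ _%:MP) => exact: free_ofC
  | |- is_true (free_of _ (mderiv _ _)) => apply: free_of_deriv
  | |- _ => first [assumption | exact: isT]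
  end.

(* Polynomials in ['X_i] as lists of coefficients, so that the coefficients of a
   product are obtained by reduction. *)
Section CoefficientLists.
Variables (K : fieldType) (n : nat) (i : 'I_n).
Local Notation A := {mpoly K[n]}.
Implicit Types (a b : A) (s t : seq A).

Definition eval_at s : A := foldr (fun a b => a + 'X_i * b) 0 s.

Fixpoint addl s t :=
  match s, t with
  | a :: s', b :: t' => a + b :: addl s' t'
  | [::], _ => t
  | _, [::] => s
  end.

Definition oppl s := [seq - a | a <- s].

Definition mull s t := foldr (fun a r => addl [seq a * b | b <- t] (0 :: r)) [::] s.

Lemma eval_addl s t : eval_at (addl s t) = eval_at s + eval_at t.
Proof.
elim: s t => [|a s IH] [|b t] /=; rewrite ?add0r ?addr0 // IH; ring.
Qed.

Lemma eval_oppl s : eval_at (oppl s) = - eval_at s.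
Proof. by elim: s => [|a s /= ->] /=; rewrite ?oppr0 //; ring. Qed.

Lemma eval_mull s t : eval_at (mull s t) = eval_at s * eval_at t.
Proof.
elim: s => [|a s IH] /=; first by rewrite mul0r.
have sc : eval_at [seq a * b | b <- t] = a * eval_at t.
  by elim: t {IH} => [|b t /= ->] /=; rewrite ?mulr0 //; ring.
by rewrite eval_addl /= sc IH; ring.
Qed.

Lemma free_addl s t :
  all (free_of i) s -> all (free_of i) t -> all (free_of i) (addl s t).
Proof.
elim: s t => [|a s IH] [|b t] //= /andP[fa fs] /andP[fb ft].
by rewrite free_ofD ?IH.
Qed.

Lemma free_oppl s : all (free_of i) s -> all (free_of i) (oppl s).
Proof. by elim: s => [|a s IH] //= /andP[fa fs]; rewrite free_ofN ?IH. Qed.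

Lemma free_mull s t :
  all (free_of i) s -> all (free_of i) t -> all (free_of i) (mull s t).
Proof.
move=> + ft; elim: s => [|a s IH] //= /andP[fa fs].
apply: free_addl; last by rewrite /= free_of0 IH.
by elim: t ft {IH} => [|b t IH] //= /andP[fb ft]; rewrite free_ofM ?IH.
Qed.

End CoefficientLists.

(** * Jacobian minors contracted with the Euler vector field *)

Section EulerContraction.
Variables (K : fieldType) (n : nat).
Hypothesis nz3 : 3%:R != 0 :> K.
Implicit Types (f g h : {mpoly K[n]}).

(** The coefficient of df ∧ dg at dx_u ∧ dx_v; [jac3] is its analogue for df ∧ dg ∧ dh. *)
Definition jac2 f g u v := f^`M(u) * g^`M(v) - f^`M(v) * g^`M(u).

Definition jac3 f g h u v w :=
  f^`M(u) * jac2 g h v w - f^`M(v) * jac2 g h u w + f^`M(w) * jac2 g h u v.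

(** Contracting df ∧ dg with the Euler field gives 3 (f dg - g df), and 3 is invertible. *)
Lemma euler_jac2 f g : f \is 3.-homog -> g \is 3.-homog ->
  (forall u v, jac2 f g u v = 0) -> forall v, f * g^`M(v) - g * f^`M(v) = 0.
Proof.
move=> hf hg J v; have ef := euler hf; have eg := euler hg.
have : \sum_u 'X_u * jac2 f g u v = 0 by rewrite big1 // => u _; rewrite J mulr0.
rewrite (eq_bigr (fun u => ('X_u * f^`M(u)) * g^`M(v) - ('X_u * g^`M(u)) * f^`M(v)));
  last by move=> u _; rewrite /jac2; ring.
rewrite sumrB -!mulr_suml ef eg -!scalerAl -scalerBr => /eqP.
by rewrite scaler_eq0 (negPf nz3) => /eqP.
Qed.

(** The contraction of df ∧ dg ∧ dh is 3 (f dg ∧ dh - g df ∧ dh + h df ∧ dg). *)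
Lemma euler_jac3 f g h : f \is 3.-homog -> g \is 3.-homog -> h \is 3.-homog ->
    (forall u v w, jac3 f g h u v w = 0) ->
  forall v w, f * jac2 g h v w - g * jac2 f h v w + h * jac2 f g v w = 0.
Proof.
move=> hf hg hh J v w; have ef := euler hf; have eg := euler hg; have eh := euler hh.
have : \sum_u 'X_u * jac3 f g h u v w = 0 by rewrite big1 // => u _; rewrite J mulr0.
rewrite (eq_bigr (fun u => ('X_u * f^`M(u)) * jac2 g h v w
   - ('X_u * g^`M(u)) * jac2 f h v w + ('X_u * h^`M(u)) * jac2 f g v w));
  last by move=> u _; rewrite /jac3 /jac2; ring.
rewrite big_split sumrB -!mulr_suml /= ef eg eh -!scalerAl -scalerBr -scalerDr => /eqP.
by rewrite scaler_eq0 (negPf nz3) => /eqP.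
Qed.

End EulerContraction.

(** * Comparison of coefficients for two and three cubic forms *)

Section SimpleCases.
Variables (K : fieldType) (n : nat) (i : 'I_n).
Hypotheses (nz2 : 2%:R != 0 :> K) (nz3 : 3%:R != 0 :> K).
Local Notation A := {mpoly K[n]}.
Implicit Types (l q c : A).

Definition cubic_coefs (h : K) l q c := [:: c; q; l; h%:MP].

Lemma eval_cubic h l q c : eval_at i (cubic_coefs h l q c) = cubic_in i h l q c.
Proof. by rewrite /= /cubic_in; ring. Qed.

Lemma free_cubic_coefs h l q c : free_of i l -> free_of i q -> free_of i c ->
  all (free_of i) (cubic_coefs h l q c).
Proof. by move=> fl fq fc; rewrite /= fl fq fc free_ofC. Qed.


(** The derivative along ['X_i] shifts the coefficients; any other derivative acts on each of them
    and kills the constant [h], whence the final 0. *)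
Definition dcubic_coefs (h : K) l q c v :=
  if v == i then [:: q; 2%:R * l; 3%:R * h%:MP]
  else [:: c^`M(v); q^`M(v); l^`M(v); 0].

Lemma eval_dcubic h l q c v : free_of i l -> free_of i q -> free_of i c ->
  eval_at i (dcubic_coefs h l q c v) = (cubic_in i h l q c)^`M(v).
Proof.
move=> fl fq fc; rewrite /dcubic_coefs.
case: eqVneq => [->|ne_v]; first by rewrite mderiv_cubic_in_lead //=; ring.
by rewrite mderiv_cubic_in //= /cubic_in mpolyC0; ring.
Qed.

Lemma free_dcubic_coefs h l q c v : free_of i l -> free_of i q -> free_of i c ->
  all (free_of i) (dcubic_coefs h l q c v).
Proof. by move=> fl fq fc; rewrite /dcubic_coefs; case: eqP => _ /=; free_tac. Qed.

Lemma euler_two d (p : A) j : p \is d.-homog ->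
  (forall v, v != j -> p^`M(v) = 0) -> 'X_j * p^`M(j) = d%:R *: p.
Proof.
by move=> hp dp; rewrite -(euler hp) (bigD1 j) //= big1 ?addr0 // => v /dp ->; rewrite mulr0.
Qed.

Section TwoForms.
Variables (h : K) (l q1 c1 q c : A).
Hypotheses (hq : q \is 2.-homog) (hc : c \is 3.-homog).
Hypotheses (fl : free_of i l) (fq1 : free_of i q1) (fc1 : free_of i c1).
Hypotheses (fq : free_of i q) (fc : free_of i c).
Let f := cubic_in i h l q1 c1.
Let g := cubic_in i 0 0 q c.
Hypothesis ratio : forall v, f * g^`M(v) - g * f^`M(v) = 0.

Lemma ratio_coefs v k :
  (addl (mull (cubic_coefs h l q1 c1) (dcubic_coefs 0 0 q c v))
        (oppl (mull (cubic_coefs 0 0 q c) (dcubic_coefs h l q1 c1 v))))`_k = 0.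
Proof.
have f0 := free_of0 K i; move: k; apply: (@free_of_horner _ _ i).
  apply: free_addl; [|apply: free_oppl]; apply: free_mull;
    by [apply: free_cubic_coefs | apply: free_dcubic_coefs].
have := ratio v; rewrite /f /g -!eval_dcubic // -!eval_cubic.
by rewrite -!eval_mull -eval_oppl -eval_addl.
Qed.

(** The coefficients of X^4 and X^3 show that all derivatives of [q] and [c] vanish. *)
Lemma ratio_lead : h = 1 -> l = 0 -> g = 0.
Proof.
move=> h1 l0; have co v := @ratio_coefs v; rewrite h1 l0 /dcubic_coefs in co.
have dq v : q^`M(v) = 0.
  have [->|/negPf ne_v] := eqVneq v i; first exact: free_of_deriv0.
  by have := co v 4%N; rewrite ne_v /= => e; rewrite -[RHS]e; ring.
have q0 : q = 0 by apply: homog_deriv0 hq dq.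
have dc v : c^`M(v) = 0.
  have [->|/negPf ne_v] := eqVneq v i; first exact: free_of_deriv0.
  by have := co v 3%N; rewrite ne_v /= q0 !mderiv0 => e; rewrite -[RHS]e; ring.
by rewrite /g /cubic_in q0 (homog_deriv0 nz3 hc dc); ring.
Qed.

(** The coefficient of X^3 kills the derivatives of [q] other than that along ['X_j], for which it
    gives ['X_j] q_j = q, while Euler gives 2 q; so q = 0. The coefficient of X^2 then gives c = 3 c
    in the same way. *)
Lemma ratio_no_lead j : j != i -> h = 0 -> l = 'X_j -> g = 0.
Proof.
move=> ne_j h0 lj; have co v := @ratio_coefs v; rewrite h0 lj /dcubic_coefs in co.
have Xj0 : 'X_j != 0 :> A by rewrite -msize_poly_eq0 msizeX.
have q0 : q = 0.
  have dq v : v != j -> q^`M(v) = 0.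
    move=> ne_vj; have [->|/negPf ne_v] := eqVneq v i; first exact: free_of_deriv0.
    have := co v 3%N; rewrite ne_v /= !mderiv0 mderivXU eq_sym (negPf ne_vj) /= => e.
    by apply/(mulfI Xj0); rewrite mulr0 -[RHS]e; ring.
  have := euler_two hq dq; have := co j 3%N.
  rewrite (negPf ne_j) /= mderivXU eqxx !mderiv0 /= => e e2.
  have: q = 0; last by []. 
  rewrite -[LHS]scale1r; have -> : 1 = 2%:R - 1 :> K by ring.
  rewrite scalerBl -e2 scale1r -[RHS]e; ring.
have c0 : c = 0.
  have dc v : v != j -> c^`M(v) = 0.
    move=> ne_vj; have [->|/negPf ne_v] := eqVneq v i; first exact: free_of_deriv0.
    have := co v 2%N; rewrite ne_v /= q0 !mderiv0 mderivXU eq_sym (negPf ne_vj) /= => e.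
    by apply/(mulfI Xj0); rewrite mulr0 -[RHS]e; ring.
  have := euler_two hc dc; have := co j 2%N.
  rewrite (negPf ne_j) /= mderivXU eqxx q0 !mderiv0 /= => e e2.
  apply: (scalerI nz2); have -> : 2%:R = 3%:R - 1 :> K by ring.
  rewrite scalerBl -e2 scale1r scaler0 -[RHS]e; ring.
by rewrite /g q0 c0 /cubic_in; ring.
Qed.

End TwoForms.

Section ThreeForms.
Variables (h1 h2 : K) (l1 q1 c1 l2 q2 c2 l q c : A).
Hypotheses (fl1 : free_of i l1) (fq1 : free_of i q1) (fc1 : free_of i c1).
Hypotheses (fl2 : free_of i l2) (fq2 : free_of i q2) (fc2 : free_of i c2).
Hypotheses (fl : free_of i l) (fq : free_of i q) (fc : free_of i c).
Let f1 := cubic_in i h1 l1 q1 c1.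
Let f2 := cubic_in i h2 l2 q2 c2.
Let g := cubic_in i 0 l q c.

Lemma jac2_coefs v w : jac2 f1 f2 v w = 0 -> forall k,
  (addl (mull (dcubic_coefs h1 l1 q1 c1 v) (dcubic_coefs h2 l2 q2 c2 w))
        (oppl (mull (dcubic_coefs h1 l1 q1 c1 w) (dcubic_coefs h2 l2 q2 c2 v))))`_k = 0.
Proof.
move=> J; apply: (@free_of_horner _ _ i).
  by apply: free_addl; [|apply: free_oppl]; apply: free_mull; apply: free_dcubic_coefs.
move: J; rewrite /f1 /f2 /jac2 -!eval_dcubic //.
by rewrite -!eval_mull -eval_oppl -eval_addl.
Qed.

(** The contraction is a polynomial in ['X_i] whose coefficient list is obtained by computation;
    later proofs pick the [k] they need. *)
Lemma jac3_coefs v w :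
    f1 * jac2 f2 g v w - f2 * jac2 f1 g v w + g * jac2 f1 f2 v w = 0 ->
  let d1 := dcubic_coefs h1 l1 q1 c1 in let d2 := dcubic_coefs h2 l2 q2 c2 in
  let d3 := dcubic_coefs 0 l q c in
  let j a b := addl (mull (a v) (b w)) (oppl (mull (a w) (b v))) in
  forall k,
  (addl (addl (mull (cubic_coefs h1 l1 q1 c1) (j d2 d3))
              (oppl (mull (cubic_coefs h2 l2 q2 c2) (j d1 d3))))
        (mull (cubic_coefs 0 l q c) (j d1 d2)))`_k = 0.
Proof.
move=> J d1 d2 d3 j; apply: (@free_of_horner _ _ i).
  by rewrite /j /d1 /d2 /d3; repeat first [apply: free_mull | apply: free_oppl
    | apply: free_cubic_coefs | apply: free_dcubic_coefs | apply: free_addl].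
move: J; rewrite /f1 /f2 /g /jac2 -!eval_dcubic // -!eval_cubic.
by rewrite -!(eval_mull, eval_oppl, eval_addl).
Qed.

End ThreeForms.
End SimpleCases.

(** * Rank two: the top coefficients of the contraction *)

Section RankTwo.
Variables (K : fieldType) (n : nat) (i : 'I_n).
Hypotheses (nz2 : 2%:R != 0 :> K) (nz3 : 3%:R != 0 :> K).
Local Notation A := {mpoly K[n]}.
Implicit Types (l q c f g : A).

Lemma mpolyX_neq0 j : 'X_j != 0 :> A.
Proof. by rewrite -msize_poly_eq0 msizeX. Qed.

(* The contraction of [df1 /\ df2 /\ dg] with the Euler vector field. *)
Definition contracted f1 f2 g :=
  forall v w, f1 * jac2 f2 g v w - f2 * jac2 f1 g v w + g * jac2 f1 f2 v w = 0.

(** At (j, v) with v outside i, j, k, the coefficients of X^5 and X^4 kill the derivatives of [q]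
    and [c] along v. At (j, k), X^5 gives q = ['X_j] q_j + ['X_k] q_k, which is 2 q by Euler; then
    X^4 gives c = 3 c. *)
Lemma contracted_no_lead j k q1 c1 q2 c2 q c :
    j != i -> k != i -> j != k ->
    q \is 2.-homog -> c \is 3.-homog ->
    free_of i q1 -> free_of i c1 -> free_of i q2 -> free_of i c2 ->
    free_of i q -> free_of i c ->
  contracted (cubic_in i 0 'X_j q1 c1) (cubic_in i 0 'X_k q2 c2) (cubic_in i 0 0 q c) ->
  cubic_in i 0 0 q c = 0.
Proof.
move=> ne_j ne_k ne_jk hq hc fq1 fc1 fq2 fc2 fq fc J.
have fj := free_ofX K ne_j; have fk := free_ofX K ne_k; have f0 := free_of0 K i.
have co v w := jac3_coefs fj fq1 fc1 fk fq2 fc2 f0 fq fc (J v w).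
rewrite /dcubic_coefs in co.
have euler_jk d (p : A) : free_of i p -> p \is d.-homog ->
    (forall v, v != i -> v != j -> v != k -> p^`M(v) = 0) ->
    d%:R *: p = 'X_j * p^`M(j) + 'X_k * p^`M(k).
  move=> fp hp dp; rewrite -(euler hp) (bigD1 j) //= (bigD1 k) 1?eq_sym //= big1 ?addr0 //.
  move=> v /andP[v_j v_k]; have [->|v_i] := eqVneq v i; first by rewrite free_of_deriv0 ?mulr0.
  by rewrite dp ?mulr0.
have dX v : v != k -> ('X_k : A)^`M(v) = 0.
  by move=> /negPf ne_v; rewrite mderivXU eq_sym ne_v.
have dXj v : v != j -> ('X_j : A)^`M(v) = 0.
  by move=> /negPf ne_v; rewrite mderivXU eq_sym ne_v.
have d1 v : ('X_v : A)^`M(v) = 1 by rewrite mderivXU eqxx.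
have ne_kj : k != j by rewrite eq_sym.
have q0 : q = 0.
  have dq v : v != i -> v != j -> v != k -> q^`M(v) = 0.
    move=> v_i v_j v_k; apply/(mulfI (mpolyX_neq0 k)); rewrite mulr0.
    have := co j v 5%N; rewrite (negPf ne_j) (negPf v_i) /= d1 !mderiv0 !dX // !dXj //.
    by move=> e; rewrite -[RHS]oppr0 -[X in - X]e; ring.
  have := euler_jk _ _ fq hq dq; have := co j k 5%N.
  rewrite (negPf ne_j) (negPf ne_k) /= !d1 !mderiv0 !dX // !dXj // => e e2.
  rewrite -[LHS]scale1r; have -> : 1 = 2%:R - 1 :> K by ring.
  rewrite scalerBl e2 scale1r -[RHS]oppr0 -[X in _ = - X]e; ring.
have c0 : c = 0.
  have dc v : v != i -> v != j -> v != k -> c^`M(v) = 0.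
    move=> v_i v_j v_k; apply/(mulfI (mpolyX_neq0 k)); rewrite mulr0.
    have := co j v 4%N; rewrite (negPf ne_j) (negPf v_i) /= q0 d1 !mderiv0 !dX // !dXj //.
    by move=> e; rewrite -[RHS]oppr0 -[X in - X]e; ring.
  have := euler_jk _ _ fc hc dc; have := co j k 4%N.
  rewrite (negPf ne_j) (negPf ne_k) /= q0 !d1 !mderiv0 !dX // !dXj // => e e2.
  apply: (scalerI nz2); have -> : 2%:R = 3%:R - 1 :> K by ring.
  rewrite scalerBl e2 scale1r scaler0 -[RHS]oppr0 -[X in _ = - X]e; ring.
by rewrite q0 c0 /cubic_in; ring.
Qed.

Variable j : 'I_n.
Hypothesis ne_j : j != i.
Local Notation Y := ('X_j : A).

Variables (q1 c1 q2 c2 : A).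
Hypotheses (hq1 : q1 \is 2.-homog) (hq2 : q2 \is 2.-homog) (hc2 : c2 \is 3.-homog).
Hypotheses (fq1 : free_of i q1) (fc1 : free_of i c1).
Hypotheses (fq2 : free_of i q2) (fc2 : free_of i c2).
Let f1 := cubic_in i 1 0 q1 c1.
Let f2 := cubic_in i 0 Y q2 c2.

Let dY v : v != j -> Y^`M(v) = 0.
Proof. by move=> /negPf ne_v; rewrite mderivXU eq_sym ne_v. Qed.

Let dYj : Y^`M(j) = 1.
Proof. by rewrite mderivXU eqxx. Qed.

Lemma homog_power_free d p : free_of i p -> p \is d.-homog -> (d < 5)%N ->
  (forall v, v != i -> v != j -> p^`M(v) = 0) -> exists a, p = a%:MP * Y ^+ d.
Proof.
move=> fp hp d5 dp; apply: homog_power hp _ => [k /andP[k0 kd]|v v_j].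
  by apply: (@natr_small_neq0 K k) => //; rewrite k0 (leq_ltn_trans kd).
have [->|v_i] := eqVneq v i; first exact: free_of_deriv0.
exact: dp.
Qed.

(* The coefficients of [X_i^6] and [X_i^5] vanish. *)
Lemma contracted_third_row q c :
    q \is 2.-homog -> c \is 3.-homog -> free_of i q -> free_of i c ->
    contracted f1 f2 (cubic_in i 0 0 q c) ->
  exists a b, q = a%:MP * Y ^+ 2 /\ c = (2%:R * a)%:MP * Y * q2 + b%:MP * Y ^+ 3.
Proof.
move=> hq hc fq fc J; have f0 := free_of0 K i; have fY := free_ofX K ne_j.
have co v w := jac3_coefs f0 fq1 fc1 fY fq2 fc2 f0 fq fc (J v w).
rewrite /dcubic_coefs in co.
have dq v : v != i -> v != j -> q^`M(v) = 0.
  move=> v_i v_j; have := co j v 6%N.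
  rewrite (negPf ne_j) (negPf v_i) /= dYj !mderiv0 !dY // => e; rewrite -[RHS]e; ring.
have [//|a ea] := homog_power_free fq hq _ dq.
have dY2 : (Y ^+ 2)^`M(j) = 2%:R * Y by rewrite expr2 mderivM dYj; ring.
have qj : q^`M(j) = (2%:R * a)%:MP * Y.
  by rewrite ea mderiv_mulC dY2 mpolyCM rmorph_nat; ring.
(* The coefficient of X^5 says that c and 2 a Y q2 have the same derivatives along all v other than
   i and j, so their difference is a multiple of Y^3. *)
have hd : c - (2%:R * a)%:MP * Y * q2 \is 3.-homog.
  rewrite rpredB // -mulrA mul_mpolyC rpredZ //.
  exact: (dhomogM (homogX K j) hq2).
have fd : free_of i (c - (2%:R * a)%:MP * Y * q2) by free_tac.
have [//|v v_i v_j|b eb] := homog_power_free fd hd; last first.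
- by exists a, b; split=> //; rewrite -eb; ring.
- have := co j v 5%N.
  rewrite (negPf ne_j) (negPf v_i) /= dYj !mderiv0 !dY // dq // qj => e.
  rewrite mderivB !mderivM mderivC dY // -[RHS]e; ring.
Qed.

Lemma nat_mpoly_neq0 k : k%:R != 0 :> K -> k%:R != 0 :> A.
Proof. by move=> nz; rewrite -(rmorph_nat (@mpolyC n K)) mpolyC_eq0. Qed.

(* The case where [Y^3] is in the span of the components: then
   [dY /\ df1 /\ df2 = 0]. *)
Lemma jac2_other_derivs v : v != i -> v != j -> jac2 f1 f2 i v = 0 ->
  [/\ f1^`M(v) = 0, f2^`M(v) = 0 & q2^`M(v) = 0].
Proof.
move=> v_i v_j J; have f0 := free_of0 K i; have fY := free_ofX K ne_j.
have co := jac2_coefs f0 fq1 fc1 fY fq2 fc2 J.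
rewrite /dcubic_coefs eqxx (negPf v_i) mderiv0 dY // in co.
have Y0 := mpolyX_neq0 j; have z2 := nat_mpoly_neq0 nz2; have z3 := nat_mpoly_neq0 nz3.
have q2v : q2^`M(v) = 0.
  have := co 3%N; rewrite /= => e.
  by apply: (mulfI z3); rewrite mulr0 -[RHS]e mpolyC0 mpolyC1; ring.
have e2 : 3%:R * c2^`M(v) = 2%:R * Y * q1^`M(v).
  have := co 2%N; rewrite /= mpolyC0 mpolyC1 => e.
  by apply/eqP; rewrite -subr_eq0 -e; apply/eqP; ring.
have e1 : 2%:R * Y * c1^`M(v) = - (q1^`M(v) * q2).
  have := co 1%N; rewrite /= q2v => e.
  by apply/eqP; rewrite -subr_eq0 -oppr_eq0 -e; apply/eqP; ring.
have e0 : q1 * c2^`M(v) - c1^`M(v) * q2 = 0.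
  by have := co 0%N; rewrite /= => e; rewrite -[RHS]e; ring.
(* Eliminating the derivatives of [c1] and [c2] from [e0] leaves q1_v (4 Y^2 q1 + 3 q2^2) = 0. If
   the second factor is zero, its derivative along v, 4 Y^2 q1_v, is zero too. *)
have q1v : q1^`M(v) = 0.
  have : q1^`M(v) * (2%:R * 2%:R * Y ^+ 2 * q1 + 3%:R * q2 ^+ 2) = 0.
    transitivity (2%:R * Y * q1 * (2%:R * Y * q1^`M(v)) - 3%:R * q2 * - (q1^`M(v) * q2)).
      by ring.
    rewrite -e2 -e1.
    transitivity (2%:R * 3%:R * Y * (q1 * c2^`M(v) - c1^`M(v) * q2)); first by ring.
    by rewrite e0 mulr0.
  move/eqP; rewrite mulf_eq0 => /orP[/eqP //|/eqP].
  move/(congr1 (mderiv v)); rewrite mderiv0 expr2 [q2 ^+ 2]expr2.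
  rewrite mderivD !mderivM q2v !dY // -!(rmorph_nat (@mpolyC n K)) !mderivC => e.
  have z : 2%:R%:MP * 2%:R%:MP * (Y * Y) != 0 :> A.
    by rewrite !mulf_neq0 ?mpolyC_eq0.
  by apply: (mulfI z); rewrite mulr0 -[RHS]e; ring.
have c1v : c1^`M(v) = 0.
  by apply: (mulfI (mulf_neq0 z2 Y0)); rewrite e1 q1v mul0r oppr0 mulr0.
have c2v : c2^`M(v) = 0 by apply: (mulfI z3); rewrite e2 q1v !mulr0.
rewrite /f1 /f2 !mderiv_cubic_in // q1v q2v c1v c2v mderiv0 dY //.
by rewrite /cubic_in !mpolyC0; split; ring.
Qed.

(* The coefficient of [X_i^4]. *)
Lemma contracted_quartic :
    contracted f1 f2 (cubic_in i 0 0 (Y ^+ 2) (2%:R * Y * q2)) ->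
  exists a, Y ^+ 2 * q1 - q2 ^+ 2 - 2%:R * Y * c2 = a%:MP * Y ^+ 4.
Proof.
move=> J; have f0 := free_of0 K i; have fY := free_ofX K ne_j.
have hY := homogX K j.
have fq : free_of i (Y ^+ 2) by free_tac.
have fc : free_of i (2%:R * Y * q2) by free_tac.
apply: homog_power_free => // [||v v_i v_j].
- by free_tac.
- rewrite !rpredB //.
  + exact: (dhomogM (dhomogMn 2 hY) hq1).
  + exact: (dhomogMn 2 hq2).
  + by rewrite -mulrA mulr_natl rpredMn // (dhomogM hY hc2).
(* At (j, v) this coefficient is exactly the derivative along v of the form in question. *)
have := jac3_coefs f0 fq1 fc1 fY fq2 fc2 f0 fq fc (J j v) 4.
rewrite /dcubic_coefs (negPf ne_j) (negPf v_i) /= dYj !mderiv0 !(dY v_j).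
rewrite !expr2 -!(rmorph_nat (@mpolyC n K)) !(mderivB, mderivM, mderivC) dYj (dY v_j).
rewrite !rmorph_nat mpolyC0 mpolyC1 => e.
by rewrite -[RHS]e; ring.
Qed.

End RankTwo.

(** * Rank two: solving the remaining coefficient equations *)

Section NormalForm.
Variables (K : fieldType) (n : nat) (i j : 'I_n).
Hypotheses (nz2 : 2%:R != 0 :> K) (nz3 : 3%:R != 0 :> K) (ne_j : j != i).
Local Notation A := {mpoly K[n]}.
Implicit Types (l q c e f g : A).
Local Notation X := ('X_i : A).
Local Notation Y := ('X_j : A).

Let fY : free_of i Y := free_ofX K ne_j.
Let f0 : free_of i 0 := free_of0 K i.
Let Y0 : Y != 0 := mpolyX_neq0 K j.
Let z2 : 2%:R != 0 :> A := nat_mpoly_neq0 n nz2.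
Let z3 : 3%:R != 0 :> A := nat_mpoly_neq0 n nz3.

Let dY v : v != j -> Y^`M(v) = 0.
Proof. by move=> /negPf ne_v; rewrite mderivXU eq_sym ne_v. Qed.

Let dYj : Y^`M(j) = 1.
Proof. by rewrite mderivXU eqxx. Qed.

Lemma homog_div_var d p : p \is d.+1.-homog -> p \mPo subst_var j 0 = 0 ->
  free_of i p -> exists p', [/\ p = Y * p', p' \is d.-homog & free_of i p'].
Proof.
move=> /homog_split -/(_ j) [p' [ep hp' _]] s0 fp; rewrite s0 add0r in ep.
exists p'; split=> //; apply/eqP/(mulfI Y0).
by rewrite -ep -[in RHS](eqP fp) [in RHS]ep rmorphM /= subst_varX (negPf ne_j).
Qed.

Section Quadratic.
Variables (l e : A) (a : K).
Hypotheses (fl : free_of i l) (fe : free_of i e).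
Let p := X - l.
Let g := X + 2%:R * l.
Let u := e + 2%:R * l ^+ 2.
Let F1 := p ^+ 2 * g + 2%:R * p * u + a%:MP * Y ^+ 3.
Let F2 := Y * (p * g + u).
Let G := Y ^+ 2 * g.

(** The last two coefficients at (i, v) amount to 3 a Y^3 l_v + 2 u u_v = 0 and a Y^3 u_v + 6 u^2
    l_v = 0. If some l_v is nonzero, they force u = 0 and a = 0. Otherwise u u_v = 0 for all these
    v, and only X and Y occur. *)
Lemma conic_normal_form : contracted F1 F2 G ->
    (forall v, v != i -> v != j -> [/\ F1^`M(v) = 0, F2^`M(v) = 0 & G^`M(v) = 0])
  \/ [/\ exists2 v, v != i /\ v != j & l^`M(v) != 0,
         F1 = p ^+ 2 * g, F2 = Y * p * g & G = Y ^+ 2 * g].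
Proof.
pose c1 := a%:MP * Y ^+ 3 - 2%:R * l * e - 2%:R * l ^+ 3.
have F1E : F1 = cubic_in i 1 0 (l ^+ 2 + 2%:R * e) c1.
  by rewrite /F1 /p /g /u /cubic_in /c1 mpolyC1; ring.
have F2E : F2 = cubic_in i 0 Y (Y * l) (Y * e).
  by rewrite /F2 /p /g /u /cubic_in mpolyC0; ring.
have GE : G = cubic_in i 0 0 (Y ^+ 2) (2%:R * Y ^+ 2 * l).
  by rewrite /G /g /cubic_in mpolyC0; ring.
have fq1 : free_of i (l ^+ 2 + 2%:R * e) by free_tac.
have fc1 : free_of i c1 by rewrite /c1; free_tac.
have fq2 : free_of i (Y * l) by free_tac.
have fc2 : free_of i (Y * e) by free_tac.
have fq : free_of i (Y ^+ 2) by free_tac.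
have fc : free_of i (2%:R * Y ^+ 2 * l) by free_tac.
rewrite {1}F1E {1}F2E {1}GE => J.
have co v := jac3_coefs f0 fq1 fc1 fY fq2 fc2 f0 fq fc (J i v).
rewrite /dcubic_coefs eqxx in co.
have duE v : u^`M(v) = e^`M(v) + 4%:R * l * l^`M(v).
  by rewrite /u expr2 !mderivE; ring.
have dc1E v : v != j ->
    c1^`M(v) = - 2%:R * (l^`M(v) * e + l * e^`M(v)) - 6%:R * l ^+ 2 * l^`M(v).
  by move=> v_j; rewrite /c1 !exprS expr0 !mderivE (dY v_j); ring.
(* The coefficients of [g] and [1] of the contraction, seen as a polynomial in [g]. *)
have eqs v : v != i -> v != j ->
    3%:R * a%:MP * Y ^+ 3 * l^`M(v) + 2%:R * u * u^`M(v) = 0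
    /\ a%:MP * Y ^+ 3 * u^`M(v) + 6%:R * u ^+ 2 * l^`M(v) = 0.
  move=> v_i v_j; have := co v 0%N; have := co v 1%N.
  rewrite (negPf v_i) /= dc1E // duE /u /c1 ?mpolyC0 ?mpolyC1.
  rewrite !expr2 !mderivE (dY v_j).
  set k1 := (X in X = 0 -> _) => e1; set k0 := (X in X = 0 -> _) => e0.
  have Y30 : Y ^+ 3 != 0 by rewrite expf_neq0.
  split; apply: (mulfI Y30); rewrite mulr0.
    by rewrite -[RHS]e1 /k1; ring.
  (* Here k0 - 2 l k1 is the value of k0 + k1 X at X = -2 l, that is, at g = 0. *)
  transitivity (- (k0 - 2%:R * l * k1)); last by rewrite e0 e1; ring.
  by rewrite /k0 /k1; ring.
have [/existsP[v /and3P[v_i v_j lv]]|/existsPn l_const] :=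
    boolP [exists v, [&& v != i, v != j & l^`M(v) != 0]].
  right; suff [u0 aY0] : u = 0 /\ a = 0.
    split; first by exists v.
    - by rewrite /F1 u0 aY0 mpolyC0; ring.
    - by rewrite /F2 u0; ring.
    - by [].
  have [eA eB] := eqs v v_i v_j.
  have cube (w : A) : a%:MP ^+ 2 * Y ^+ 6 - 4%:R * w ^+ 3 = 0 -> w^`M(v) = 0.
    move=> /(congr1 (mderiv v)); rewrite !exprS expr0 !mderivE (dY v_j) => e3.
    have /eqP : (2%:R * 2%:R * 3%:R) * (w * (w * w^`M(v))) = 0.
      by rewrite -[RHS]oppr0 -[X in _ = - X]e3; ring.
    rewrite !mulf_eq0 (negPf z2) (negPf z3) /= orbA orbb => /orP[/eqP ->|/eqP //].
    by rewrite mderiv0.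
  have uv : u^`M(v) = 0.
    (* a Y^3 times the first equation minus 2 u times the second is 3 l_v (a^2 Y^6 - 4 u^3). *)
    have : l^`M(v) * (a%:MP ^+ 2 * Y ^+ 6 - 4%:R * u ^+ 3) = 0.
      apply: (mulfI z3); rewrite mulr0.
      transitivity (a%:MP * Y ^+ 3 * 0 - 2%:R * u * 0 : A); last by ring.
      by rewrite -{1}eA -eB; ring.
    by move/eqP; rewrite mulf_eq0 (negPf lv) => /eqP /cube.
  have u0 : u = 0.
    have e6 : 6%:R = 2%:R * 3%:R :> A by ring.
    move/eqP: eB; rewrite uv mulr0 add0r e6 expr2 !mulf_eq0.
    by rewrite (negPf z2) (negPf z3) (negPf lv) !orbF /= orbb => /eqP.
  have Y3 : Y ^+ 3 != 0 by rewrite expf_neq0.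
  split=> //; apply/eqP; rewrite -(mpolyC_eq0 n); apply/eqP/(mulfI z3)/(mulIf Y3).
  by apply: (mulIf lv); rewrite mulr0 !mul0r -eA u0; ring.
left => v v_i v_j; have lv : l^`M(v) = 0.
  by have := l_const v; rewrite v_i v_j /= negbK => /eqP.
have [eA _] := eqs v v_i v_j.
have uv : u^`M(v) = 0.
  move/eqP: eA; rewrite lv mulr0 add0r !mulf_eq0 (negPf z2) /= => /orP[/eqP ->|/eqP //].
  by rewrite mderiv0.
have ev : e^`M(v) = 0 by move: uv; rewrite duE lv mulr0 addr0.
rewrite F1E F2E GE !mderiv_cubic_in //.
rewrite !expr2 dc1E // !mderivE (dY v_j) lv ev /cubic_in mpolyC0.
by split; ring.
Qed.

End Quadratic.

(** The contraction is alternating, so multiples of [g] added to [f1] and [f2] cancel. *)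
Lemma contracted_shift f1 f2 g (a b : K) : contracted f1 f2 g ->
  contracted (f1 + a%:MP * g) (f2 + b%:MP * g) g.
Proof.
by move=> J v w; rewrite -[RHS](J v w) /jac2 !mderivE; ring.
Qed.

Section Generic.
Variables (q1 c1 q2 c2 : A) (b : K).
Hypotheses (hq1 : q1 \is 2.-homog) (hc1 : c1 \is 3.-homog).
Hypotheses (hq2 : q2 \is 2.-homog) (hc2 : c2 \is 3.-homog).
Hypotheses (fq1 : free_of i q1) (fc1 : free_of i c1).
Hypotheses (fq2 : free_of i q2) (fc2 : free_of i c2).
Let f1 := cubic_in i 1 0 q1 c1.
Let f2 := cubic_in i 0 Y q2 c2.
Let g := cubic_in i 0 0 (Y ^+ 2) (2%:R * Y * q2 + b%:MP * Y ^+ 3).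

Let hY := homogX K j.

(** Adding multiples of [g] to [f1] and [f2] brings the triple, coefficient by coefficient, to the
    shape treated in [conic_normal_form]. *)
Lemma contracted_cases : contracted f1 f2 g ->
    (forall v, v != i -> v != j -> [/\ f1^`M(v) = 0, f2^`M(v) = 0 & g^`M(v) = 0])
  \/ exists l, exists a d : K,
     [/\ l \is 1.-homog, free_of i l & exists2 v, v != i /\ v != j & l^`M(v) != 0]
     /\ [/\ f1 + a%:MP * g = (X - l) ^+ 2 * (X + 2%:R * l),
            f2 + d%:MP * g = Y * (X - l) * (X + 2%:R * l)
          & g = Y ^+ 2 * (X + 2%:R * l)].
Proof.
(* With 2 d = b, replacing [f2] by f2 + d g absorbs the term b Y^3 of [g] into 2 Y q2'. *)
move=> J; pose d := b / 2%:R; have db : b%:MP = 2%:R * d%:MP :> A.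
  by rewrite -(rmorph_nat (@mpolyC n K)) -mpolyCM mulrC divfK.
have hX3 k (p : A) : p \is k.-homog -> forall a : K, a%:MP * p \is k.-homog.
  by move=> hp a; rewrite mul_mpolyC rpredZ.
pose q2' := q2 + d%:MP * Y ^+ 2.
pose c2' := c2 + d%:MP * (2%:R * Y * q2 + b%:MP * Y ^+ 3).
have hq2' : q2' \is 2.-homog by rewrite rpredD ?hX3 // (dhomogMn 2 hY).
have h3 : 2%:R * Y * q2 + b%:MP * Y ^+ 3 \is 3.-homog.
  rewrite rpredD ?hX3 ?(dhomogMn 3 hY) // -mulrA mulr_natl rpredMn //.
  exact: (dhomogM hY hq2).
have hc2' : c2' \is 3.-homog by rewrite rpredD ?hX3.
have fq2' : free_of i q2' by rewrite /q2'; free_tac.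
have fc2' : free_of i c2' by rewrite /c2'; free_tac.
have gE : g = cubic_in i 0 0 (Y ^+ 2) (2%:R * Y * q2').
  by rewrite /g /q2' /cubic_in db; ring.
have f2E : f2 + d%:MP * g = cubic_in i 0 Y q2' c2'.
  by rewrite /f2 /g /q2' /c2' /cubic_in mpolyC0; ring.
have J2 : contracted f1 (cubic_in i 0 Y q2' c2') g.
  have := contracted_shift 0 d J.
  by rewrite f2E mpolyC0 mul0r addr0.
(* Subtracting a g from [f1] removes the term a Y^4, which leaves Y^2 q1' = q2'^2 + 2 Y c2'. *)
have [a ea] : exists a, Y ^+ 2 * q1 - q2' ^+ 2 - 2%:R * Y * c2' = a%:MP * Y ^+ 4.
  by move: J2; rewrite gE; apply: contracted_quartic.
pose q1' := q1 - a%:MP * Y ^+ 2; pose c1' := c1 - a%:MP * (2%:R * Y * q2').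
have fq1' : free_of i q1' by rewrite /q1'; free_tac.
have fc1' : free_of i c1' by rewrite /c1'; free_tac.
have hc1' : c1' \is 3.-homog.
  rewrite rpredB ?hX3 // -mulrA mulr_natl rpredMn //; exact: (dhomogM hY hq2').
have f1E : f1 + (- a)%:MP * g = cubic_in i 1 0 q1' c1'.
  by rewrite gE /f1 /q1' /c1' /cubic_in mpolyCN mpolyC0; ring.
have {ea} e4 : Y ^+ 2 * q1' = q2' ^+ 2 + 2%:R * Y * c2'.
  have -> : Y ^+ 2 * q1' = Y ^+ 2 * q1 - a%:MP * Y ^+ 4 by rewrite /q1'; ring.
  by rewrite -ea; ring.
clearbody q1' c1' q2' c2'.
have sY (p : A) : (Y * p) \mPo subst_var j 0 = 0.
  by rewrite rmorphM /= subst_varX eqxx mpolyC0 mul0r.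
(* Y divides q2'^2, hence q2' = Y l; then Y (q1' - l^2) = 2 c2' gives c2' = Y e and q1' = l^2 + 2
   e. *)
have [l [lE hl fl]] : exists l, [/\ q2' = Y * l, l \is 1.-homog & free_of i l].
  apply: homog_div_var => //; apply/eqP; rewrite -[_ == 0]orbb -mulf_eq0 -rmorphM -expr2 /=.
  have -> : q2' ^+ 2 = Y * (Y * q1' - 2%:R * c2').
    by rewrite -[LHS](addrK (2%:R * Y * c2')) -e4; ring.
  by rewrite sY.
have e5 : Y * (q1' - l ^+ 2) = 2%:R * c2'.
  apply: (mulfI Y0); transitivity (Y ^+ 2 * q1' - (Y * l) ^+ 2); first by ring.
  by rewrite e4 lE; ring.
have [e [eE he fe]] : exists e, [/\ c2' = Y * e, e \is 2.-homog & free_of i e].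
  apply: homog_div_var => //; apply: (mulfI z2); rewrite mulr0.
  by rewrite -(sY (q1' - l ^+ 2)) e5 rmorphM rmorph_nat.
have q1E : q1' = l ^+ 2 + 2%:R * e.
  apply: (mulfI Y0); rewrite -[LHS](subrK (Y * l ^+ 2)) -mulrBr e5 eE; ring.
have J3 := contracted_shift (- a) d J.
rewrite f1E f2E gE in J3.
(* The coefficient of X^3 at (j, v) is Y^2 times the derivative of this form along v, so the form is
   a multiple of Y^3. *)
have [t et] : exists t, c1' + 2%:R * l * e + 2%:R * l ^+ 3 = t%:MP * Y ^+ 3.
  apply: (@homog_power_free _ _ i) => //; first by free_tac.
    rewrite -!mulrA !mulr_natl; apply: rpredD; last exact/rpredMn/(dhomogMn 3 hl).
    by apply: rpredD => //; apply/rpredMn/(dhomogM hl he).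
  move=> v v_i v_j.
  have fq : free_of i (Y ^+ 2) by free_tac.
  have fc : free_of i (2%:R * Y * q2') by free_tac.
  have := jac3_coefs f0 fq1' fc1' fY fq2' fc2' f0 fq fc (J3 j v) 3.
  rewrite /dcubic_coefs (negPf ne_j) (negPf v_i) /= q1E lE eE !exprS !expr0.
  rewrite !mderivE dYj (dY v_j) mpolyC0 mpolyC1.
  set k := (X in X = 0 -> _) => e3; apply: (mulfI (expf_neq0 2 Y0)).
  by rewrite [RHS]mulr0 -[RHS]e3 /k; ring.
have c1E : c1' = t%:MP * Y ^+ 3 - 2%:R * l * e - 2%:R * l ^+ 3 by rewrite -et; ring.
pose p : A := X - l; pose g0 : A := X + 2%:R * l; pose u := e + 2%:R * l ^+ 2.
have F1E : f1 + (- a)%:MP * g = p ^+ 2 * g0 + 2%:R * p * u + t%:MP * Y ^+ 3.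
  by rewrite f1E q1E c1E /p /g0 /u /cubic_in mpolyC1; ring.
have F2E : f2 + d%:MP * g = Y * (p * g0 + u).
  by rewrite f2E lE eE /p /g0 /u /cubic_in mpolyC0; ring.
have GE : g = Y ^+ 2 * g0 by rewrite gE lE /g0 /cubic_in mpolyC0; ring.
have J4 := contracted_shift (- a) d J; rewrite F1E F2E GE in J4.
have [dF|[lv E1 E2 _]] := conic_normal_form fl fe J4.
  left=> v v_i v_j; have [] := dF v v_i v_j.
  rewrite -/p -/g0 -/u -F1E -F2E -GE => d1 d2 d3; split=> //.
    by move: d1; rewrite (mderivD v f1) mderiv_mulC d3 mulr0 addr0.
  by move: d2; rewrite (mderivD v f2) mderiv_mulC d3 mulr0 addr0.
right; exists l, (- a), d; split; first by [].
by split; [rewrite F1E E1 | rewrite F2E E2 | rewrite GE].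
Qed.

End Generic.

End NormalForm.

(** * Linear substitutions and values at a unit vector *)

Section LinearChange.
Variables (K : fieldType) (n : nat).
Local Notation A := {mpoly K[n]}.
Implicit Types (p : A) (T : 'M[K]_n).

Definition linear_tuple T : n.-tuple A :=
  [tuple (const_mpoly_mx n T *m (\col_(j < n) 'X_j)) i 0 | i < n].

Lemma linear_tupleE T i : tnth (linear_tuple T) i = \sum_k (T i k)%:MP * 'X_k.
Proof. by rewrite tnth_mktuple !mxE; apply: eq_bigr => k _; rewrite !mxE. Qed.

Definition subst T p := p \mPo linear_tuple T.

Lemma substX T i : subst T 'X_i = \sum_k (T i k)%:MP * 'X_k.
Proof. by rewrite /subst comp_mpolyXU -tnth_nth linear_tupleE. Qed.

Lemma substB T p q : subst T (p - q) = subst T p - subst T q.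
Proof. exact: rmorphB. Qed.

Lemma substM T p q : subst T (p * q) = subst T p * subst T q.
Proof. exact: rmorphM. Qed.

Lemma substXn T p k : subst T (p ^+ k) = subst T p ^+ k.
Proof. exact: rmorphXn. Qed.

Lemma substC T c : subst T c%:MP = c%:MP.
Proof. exact: comp_mpolyC. Qed.

Lemma subst_homog d T p : p \is d.-homog -> subst T p \is d.-homog.
Proof.
apply: homog_comp => // i; rewrite linear_tupleE; apply: rpred_sum => k _.
by rewrite mul_mpolyC rpredZ ?homogX.
Qed.

Lemma subst_mul T1 T2 p : subst T2 (subst T1 p) = subst (T1 *m T2) p.
Proof.
rewrite /subst comp_mpoly_comp; congr comp_mpoly; apply: eq_from_tnth => i.
rewrite tnth_mktuple !linear_tupleE rmorph_sum /=.
under eq_bigr => k _.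
  rewrite rmorphM /= comp_mpolyC -/(subst T2 _) substX mulr_sumr; over.
rewrite exchange_big /=; apply: eq_bigr => j _; rewrite mxE rmorph_sum mulr_suml.
by apply: eq_bigr => k _; rewrite mulrA -mpolyCM.
Qed.

Lemma subst1 p : subst 1%:M p = p.
Proof.
rewrite -[RHS]comp_mpoly_id; congr comp_mpoly; apply: eq_from_tnth => i.
rewrite linear_tupleE tnth_mktuple (bigD1 i) //= big1 ?addr0.
  by rewrite mxE eqxx mpolyC1 mul1r.
by move=> k /negPf ne_k; rewrite mxE eq_sym ne_k mpolyC0 mul0r.
Qed.

Lemma subst_deriv T p j :
  (subst T p)^`M(j) = \sum_k subst T p^`M(k) * (T k j)%:MP.
Proof.
rewrite mderiv_comp; apply: eq_bigr => k _; congr (_ * _).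
rewrite linear_tupleE raddf_sum (bigD1 j) //= big1 ?addr0.
  by rewrite mderiv_mulC mderivXU eqxx mulr1.
by move=> l /negPf ne_l; rewrite mderiv_mulC mderivXU ne_l mulr0.
Qed.

Lemma subst_eval T p (v : 'cV[K]_n) :
  (subst T p).@[fun i => v i 0] = p.@[fun i => (T *m v) i 0].
Proof.
rewrite comp_mpoly_meval; apply: meval_eq => i; rewrite linear_tupleE raddf_sum mxE /=.
by apply: eq_bigr => k _; rewrite mevalM mevalC mevalXU.
Qed.

Lemma linear_formP p : p \is 1.-homog ->
  exists c : 'I_n -> K, p = \sum_v (c v)%:MP * 'X_v
                        /\ forall v, p^`M(v) = (c v)%:MP.
Proof.
move=> hp; exists (fun v => (p^`M(v))@_0).
have dp v : p^`M(v) = ((p^`M(v))@_0)%:MP.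
  have [c ->] := homog0_const (mderiv_homog v hp); by rewrite mcoeffC eqxx mulr1.
split=> //; rewrite -[LHS]scale1r -(euler hp).
by apply: eq_bigr => v _; rewrite mulrC -dp.
Qed.

Lemma subst_linear_form T (c : 'rV[K]_n) :
  subst T (\sum_v (c 0 v)%:MP * 'X_v) = \sum_v ((c *m T) 0 v)%:MP * 'X_v.
Proof.
rewrite /subst rmorph_sum /=.
under eq_bigr => v _.
  rewrite rmorphM /= comp_mpolyC -/(subst T _) substX mulr_sumr; over.
rewrite exchange_big; apply: eq_bigr => k _; rewrite mxE rmorph_sum mulr_suml.
by apply: eq_bigr => v _; rewrite mulrA -mpolyCM.
Qed.

Lemma meval_homog0 d p : p \is d.+1.-homog -> p.@[fun=> 0] = 0.
Proof.
move=> /dhomogP hp; rewrite mevalE big_seq big1 // => m /hp hm.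
have [i mi] : exists i, m i != 0%N.
  apply/existsP; apply: contraPT hm => /existsPn m0 hm.
  have : mdeg m = d.+1 by [].
  by rewrite mdegE big1 // => i _; have := m0 i; rewrite negbK => /eqP.
by rewrite (bigD1 i) //= expr0n (negPf mi) mul0r mulr0.
Qed.

Definition unit_point (i : 'I_n) : 'I_n -> K := fun j => (j == i)%:R.

(** At this unit vector all variables but ['X_i] are zero, and a form of positive degree vanishes at
    the origin. *)
Lemma meval_free d i p : free_of i p -> p \is d.+1.-homog ->
  p.@[unit_point i] = 0.
Proof.
move=> /eqP fp hp; rewrite -fp comp_mpoly_meval -[RHS](meval_homog0 hp).
apply: meval_eq => j; rewrite tnth_mktuple.
case: eqVneq => [_|ne_j]; first exact: mevalC.
by rewrite mevalXU /unit_point (negPf ne_j).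
Qed.

(** At the unit vector only the leading terms survive: the derivative along ['X_i] is 3 h, and the
    one along another ['X_j] is the coefficient of ['X_j] in [l]. *)
Lemma cubic_at_point i p : 3%:R != 0 :> K -> p \is 3.-homog ->
  let d j := p^`M(j).@[unit_point i] in
  exists q c, [/\ p = cubic_in i (d i / 3%:R) (\sum_(j | j != i) (d j)%:MP * 'X_j) q c,
    q \is 2.-homog, c \is 3.-homog, free_of i q & free_of i c].
Proof.
move=> nz3 /(cubic_inP i)[h [l [q [c [[-> hl hq hc] [fl fq fc]]]]]] d.
have ui : unit_point i i = 1 by rewrite /unit_point eqxx.
exists q, c; split=> //; congr (cubic_in i _ _ q c).
  rewrite /d mderiv_cubic_in_lead // !(rmorphD, rmorphM, rmorphXn) /= mevalXU.
  rewrite (meval_free fl hl) (meval_free fq hq) ui mulr0 !addr0.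
  by apply: (mulIf nz3); rewrite divfK // !mevalC; ring.
have [a [la da]] := linear_formP hl; rewrite {1}la (bigD1 i) //= -da free_of_deriv0 //.
rewrite mul0r add0r; apply: eq_bigr => j ne_j; congr (_%:MP * _).
rewrite /d mderiv_cubic_in // da /cubic_in !(rmorphD, rmorphM, rmorphXn) /= mevalXU.
rewrite (meval_free (free_of_deriv j fq) (mderiv_homog j hq)).
rewrite (meval_free (free_of_deriv j fc) (mderiv_homog j hc)) !mevalC.
by rewrite ui; ring.
Qed.

End LinearChange.

(** * The Jacobian under linear changes, and a point of generic rank *)

Section JacobianLinearChange.
Variables (K : fieldType) (m n : nat).
Local Notation A := {mpoly K[n]}.
Implicit Types (H : 'cV[A]_m) (S : 'M[K]_m) (T : 'M[K]_n).

Lemma linear_changeE S T H i :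
  linear_change S T H i 0 = \sum_k (S i k)%:MP * subst T (H k 0).
Proof. by rewrite mxE; apply: eq_bigr => k _; rewrite !mxE. Qed.

Lemma linear_change_mul S1 T1 S2 T2 H :
  linear_change S2 T2 (linear_change S1 T1 H) = linear_change (S2 *m S1) (T1 *m T2) H.
Proof.
apply/colP => i; rewrite [LHS]linear_changeE [RHS]linear_changeE.
have lcE k : subst T2 (linear_change S1 T1 H k 0) =
    \sum_l (S1 k l)%:MP * subst (T1 *m T2) (H l 0).
  rewrite [linear_change _ _ _ _ _]linear_changeE [LHS]rmorph_sum; apply: eq_bigr => l _.
  by rewrite [LHS]rmorphM /= comp_mpolyC -/(subst T2 _) subst_mul.
transitivity (\sum_k \sum_l (S2 i k)%:MP * ((S1 k l)%:MP * subst (T1 *m T2) (H l 0))).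
  by apply: eq_bigr => k _; rewrite lcE mulr_sumr.
rewrite exchange_big; apply: eq_bigr => l _ /=; rewrite mxE rmorph_sum mulr_suml.
by apply: eq_bigr => k _; rewrite mulrA -mpolyCM.
Qed.

Lemma linear_change_homog S T H :
  cubic_homogeneous H -> cubic_homogeneous (linear_change S T H).
Proof.
move=> hH i; rewrite linear_changeE; apply: rpred_sum => k _.
by rewrite mul_mpolyC rpredZ // subst_homog.
Qed.

Lemma jacobian_linear_change S T H : mpoly_jacobian (linear_change S T H) =
  const_mpoly_mx n S *m map_mx (subst T) (mpoly_jacobian H) *m const_mpoly_mx n T.
Proof.
apply/matrixP => i j; rewrite [LHS]mxE linear_changeE raddf_sum /= mxE.
under eq_bigr => k _ do rewrite mderiv_mulC subst_deriv mulr_sumr.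
rewrite exchange_big; apply: eq_bigr => l _; rewrite mxE mulr_suml.
by apply: eq_bigr => k _; rewrite !mxE mulrA.
Qed.

(** Constant factors do not raise the rank, and each minor of the substituted Jacobian is a
    substituted minor. *)
Lemma rank_jacobian_linear_change S T H :
  (mpoly_rank (mpoly_jacobian (linear_change S T H))
     <= mpoly_rank (mpoly_jacobian H))%N.
Proof.
rewrite jacobian_linear_change /mpoly_rank !map_mxM.
apply: leq_trans (mxrankM_maxl _ _) _; apply: leq_trans (mxrankM_maxr _ _) _.
apply/tofrac_rank_minor.
have /tofrac_rank_minor[f [g]] :=
  leqnn (\rank (map_mx (@FracField.tofrac A) (map_mx (subst T) (mpoly_jacobian H)))).
move=> nz; exists f, g; apply: contra_neq nz => e.
by rewrite -map_mxsub /subst det_map_mx e rmorph0.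
Qed.

Lemma rank_jacobian_jac2 H : (mpoly_rank (mpoly_jacobian H) <= 1)%N ->
  forall i j u v, jac2 (H i 0) (H j 0) u v = 0.
Proof.
move=> rk i j u v; apply: contraTeq rk => nz; rewrite -ltnNge.
apply/(@tofrac_rank_minor _ _ _ 2); exists (tnth [tuple i; j]), (tnth [tuple u; v]).
by rewrite det_mxsub2 !mxE.
Qed.

Lemma rank_jacobian_jac3 H : (mpoly_rank (mpoly_jacobian H) <= 2)%N ->
  forall i j k u v w, jac3 (H i 0) (H j 0) (H k 0) u v w = 0.
Proof.
move=> rk i j k u v w; apply: contraTeq rk => nz; rewrite -ltnNge.
apply/(@tofrac_rank_minor _ _ _ 3).
exists (tnth [tuple i; j; k]), (tnth [tuple u; v; w]).
by rewrite det_mxsub3 !mxE.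
Qed.

Definition jacobian_at H (a : 'cV[K]_n) : 'M[K]_(m, n) :=
  map_mx (meval (fun i => a i 0)) (mpoly_jacobian H).

Lemma jacobian_at_linear_change S T H a :
  jacobian_at (linear_change S T H) a = S *m jacobian_at H (T *m a) *m T.
Proof.
rewrite /jacobian_at jacobian_linear_change !map_mxM.
congr (_ *m _ *m _); apply/matrixP => i j; rewrite !mxE;
  by [apply: mevalC | apply: subst_eval].
Qed.

Lemma homog_det r (M : 'M[A]_r) d :
  (forall i j, M i j \is d.-homog) -> \det M \is (r * d).-homog.
Proof.
move=> hM; apply: rpred_sum => s _.
have sgn (b : bool) : (-1) ^+ b = ((-1) ^+ b : K)%:MP :> A by rewrite rmorphXn rmorphN1.
rewrite sgn mul_mpolyC rpredZ //.
have -> : (r * d = \sum_(i < r) d)%N by rewrite sum_nat_const card_ord.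
elim/big_rec2: _ => [|i q e _ hq]; first exact: dhomog1.
exact: dhomogM.
Qed.

Lemma homog_msize d (p : A) : p \is d.-homog -> (msize p <= d.+1)%N.
Proof.
by move=> /dhomogP hp; rewrite msizeE; apply/bigmax_leqP_seq => k /hp /= ->.
Qed.

(** A nonzero [r]-minor is a form of degree 2 r, at most 4, so it is nonzero at some point; larger
    minors vanish identically. *)
Lemma generic_rank_point H r : 2%N \notin [pchar K] -> 3%N \notin [pchar K] ->
    cubic_homogeneous H -> r = mpoly_rank (mpoly_jacobian H) -> (r <= 2)%N ->
  exists a, \rank (jacobian_at H a) = r.
Proof.
move=> c2 c3 hH rE r2.
have det_at a k f g : \det (mxsub f g (jacobian_at H a) : 'M_k)
    = (\det (mxsub f g (mpoly_jacobian H))).@[fun i => a i 0].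
  by rewrite -map_mxsub det_map_mx.
have hJ i j : mpoly_jacobian H i j \is 2.-homog by rewrite mxE mderiv_homog.
have /tofrac_rank_minor[f [g nz]] : (r <= mpoly_rank (mpoly_jacobian H))%N by rewrite -rE.
have [|v hv] := mpoly_degree4_nonzero_point c2 c3 nz.
  apply: leq_trans (homog_msize (d := r * 2) _) _; last by rewrite ltnS (leq_mul2r _ _ 2).
  by apply: homog_det => i j; rewrite mxE.
exists (\col_i v i); apply/eqP; rewrite eqn_leq leqNgt; apply/andP; split; last first.
  apply/rank_minor; exists f, g; rewrite det_at; apply: contra_neq hv => <-.
  by apply: meval_eq => i; rewrite mxE.
apply/negP => /rank_minor[f' [g']]; rewrite det_at => nz'.
suff : (r < mpoly_rank (mpoly_jacobian H))%N by rewrite -rE ltnn.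
by apply/tofrac_rank_minor; exists f', g'; apply: contra_neq nz' => ->; rewrite meval0.
Qed.

(** Euler's identity for all components at once; it decides whether [a] lies in the kernel of its
    own Jacobian. *)
Lemma jacobian_at_euler H a : cubic_homogeneous H ->
  jacobian_at H a *m a = 3%:R *: \col_i (H i 0).@[fun j => a j 0].
Proof.
move=> hH; apply/colP => i; rewrite !mxE -mevalZ -(euler (hH i)) raddf_sum /=.
by apply: eq_bigr => j _; rewrite !mxE mevalM mevalXU mulrC.
Qed.

Lemma jacobian_at0 H : cubic_homogeneous H -> jacobian_at H 0 = 0.
Proof.
move=> hH; apply/matrixP => i j; rewrite !mxE -[RHS](meval_homog0 (mderiv_homog j (hH i))).
by apply: meval_eq => k; rewrite mxE.
Qed.

End JacobianLinearChange.

(** * Matrix normal forms with a prescribed first basis vector *)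

Section MatrixNormalForms.
Variable K : fieldType.

Lemma row_free_complete k n (C : 'M[K]_(k, n)) :
  row_free C -> exists2 g : 'M[K]_n, g \in unitmx & C = pid_mx k *m g.
Proof.
move=> fC; have le_kn : (k <= n)%N.
  by rewrite -(eqP (fC : \rank C == k)) rank_leq_col.
have CE : (pid_mx k : 'M_(k, n)) *m ((pid_mx k : 'M_(n, k)) *m C) = C.
  by rewrite mulmxA mul_pid_mx minnn (minn_idPr le_kn) pid_mx_1 mul1mx.
have [|g gU e] := complete_unitmx (U := pid_mx k : 'M[K]_(k, n)) (f := pid_mx k *m C).
  by rewrite CE (eqP (fC : \rank C == k)) rank_pid_mx.
by exists g => //; rewrite -e CE.
Qed.

Lemma first_basis_vector n (a : 'cV[K]_n.+1) : a != 0 ->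
  exists2 T : 'M[K]_n.+1, T \in unitmx & T *m delta_mx 0 0 = a.
Proof.
move=> a0; have [|g gU e] := row_free_complete (C := a^T).
  by rewrite /row_free eqn_leq rank_leq_row lt0n mxrank_eq0 trmx_eq0.
exists g^T; first by rewrite unitmx_tr.
rewrite -[RHS]trmxK e trmx_mul; congr (_ *m _).
by apply/matrixP => i j; rewrite !mxE ord1; case: i => [[|i] hi].
Qed.

Lemma block_fix_first n (B : 'M[K]_(1, n)) (R : 'M[K]_n) :
  (block_mx 1%:M B 0 R : 'M_n.+1) *m delta_mx 0 0 = delta_mx 0 0 :> 'cV_n.+1.
Proof.
rewrite -colE; apply/colP => i; rewrite !mxE eqxx andbT.
have l0 : split (0 : 'I_(1 + n)) = inl 0 by case: splitP => j //= _; rewrite ord1.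
case: (splitP (i : 'I_(1 + n))) => j ij; rewrite !mxE l0 !mxE -!val_eqE /= ij //.
Qed.

Lemma rank_mul_unit m n (S : 'M[K]_m) (M : 'M[K]_(m, n)) (T : 'M[K]_n) :
  S \in unitmx -> T \in unitmx -> \rank (S *m M *m T) = \rank M.
Proof.
move=> uS uT; rewrite mxrankMfree ?row_free_unit //.
by rewrite -mxrank_tr trmx_mul mxrankMfree ?mxrank_tr // row_free_unit unitmx_tr.
Qed.

Lemma normal_form_pid m n (M : 'M[K]_(m, n)) : exists S T,
  [/\ S \in unitmx, T \in unitmx & S *m M *m T = pid_mx (\rank M)].
Proof.
exists (invmx (col_ebase M)), (invmx (row_ebase M)).
rewrite !unitmx_inv col_ebase_unit row_ebase_unit; split=> //.
rewrite -{2}(mulmx_ebase M) -mulmxA mulmxK ?row_ebase_unit //.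
by rewrite mulmxA mulVmx ?col_ebase_unit // mul1mx.
Qed.

(** Once [a] is the first basis vector, the first column is zero. The other columns are normalized
    by [S] and a block that fixes this vector, so the ones lie one place right of the diagonal. *)
Lemma normal_form_kernel m n (M : 'M[K]_(m, n.+1)) (a : 'cV[K]_n.+1) :
    a != 0 -> M *m a = 0 -> exists S T,
  [/\ S \in unitmx, T \in unitmx, T *m delta_mx 0 0 = a
    & forall i j, (S *m M *m T) i j = ((i.+1 == j :> nat) && (i < \rank M)%N)%:R].
Proof.
move=> a0 Ma; have [T0 uT0 T0a] := first_basis_vector a0.
pose N : 'M_(m, 1 + n) := M *m T0.
have NE : N = row_mx 0 (rsubmx N).
  rewrite -[LHS]hsubmxK; congr row_mx; apply/colP => i.
  have /colP/(_ i) : M *m T0 *m (delta_mx 0 0 : 'cV_n.+1) = 0 by rewrite -mulmxA T0a Ma.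
  rewrite -colE !mxE => e; rewrite -[RHS]e; apply: eq_bigr => k _.
  by congr (_ * T0 k _); apply/val_inj.
have rkN : \rank (rsubmx N) = \rank M.
  rewrite -(rank_row_0mx 1) -NE -[M in RHS]mulmx1 -(mulmxV uT0) mulmxA.
  by rewrite mxrankMfree // row_free_unit unitmx_inv.
have [S [R [uS uR SNR]]] := normal_form_pid (rsubmx N).
pose D : 'M_(1 + n) := block_mx 1%:M 0 0 R.
have uD : D \in unitmx by rewrite block_diag_mx_unit unitmx1.
exists S, (T0 *m D); split=> //; first by rewrite unitmx_mul uT0.
  by rewrite -T0a -mulmxA block_fix_first.
move=> i j; have -> : S *m M *m (T0 *m D) = S *m N *m D by rewrite /N !mulmxA.
have -> : S *m N *m D = row_mx 0 (pid_mx (\rank M)) :> 'M_(m, 1 + n).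
  rewrite NE mul_mx_row mul_row_block !mulmx0 !mul0mx !add0r.
  by rewrite -rkN -SNR.
have -> : j = cast_ord (erefl (1 + n)%N) j by apply/val_inj.
rewrite mxE; case: splitP => k jk; first by rewrite mxE jk ord1.
by rewrite mxE jk add1n eqSS.
Qed.

(** Both [a] and [h] become first basis vectors, so the first column is [c] times one. The rest of
    the first row is cleared and the lower right block normalized, by column operations fixing the
    first basis vector. *)
Lemma normal_form_image m n (M : 'M[K]_(m.+1, n.+1)) (a : 'cV[K]_n.+1)
    (h : 'cV[K]_m.+1) (c : K) :
    a != 0 -> h != 0 -> c != 0 -> M *m a = c *: h -> exists S T,
  [/\ S \in unitmx, T \in unitmx, T *m delta_mx 0 0 = a
    & forall i j, (S *m M *m T) i j =
        if i == 0 then c * (j == 0)%:R else ((i == j :> nat) && (i < \rank M)%N)%:R].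
Proof.
move=> a0 h0 c0 Ma; have [T0 uT0 T0a] := first_basis_vector a0.
have [S0 uS0 S0h] := first_basis_vector h0.
have uS0' : invmx S0 \in unitmx by rewrite unitmx_inv.
pose N : 'M_(m.+1, n.+1) := invmx S0 *m M *m T0.
have N0 : N *m delta_mx 0 0 = c *: delta_mx 0 0 :> 'cV_m.+1.
  by rewrite /N -!mulmxA T0a Ma -S0h -scalemxAr mulKmx.
have ND : N = invmx S0 *m M *m T0 by [].
clearbody N; pose N' : 'M_(1 + m, 1 + n) := N.
have ul : ulsubmx N' = c%:M.
  apply/matrixP => i j; have /matrixP/(_ 0 0) := N0.
  rewrite -colE !mxE !ord1 eqxx mulr1 => <-.
  by congr (N _ _); apply/val_inj.
have dl : dlsubmx N' = 0.
  apply/matrixP => i j; have /matrixP/(_ (rshift 1 i : 'I_m.+1) 0) := N0.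
  rewrite -colE !mxE ord1 /= mulr0 => <-.
  by congr (N _ _); apply/val_inj.
have NE : N = block_mx c%:M (ursubmx N') 0 (drsubmx N') by rewrite -ul -dl submxK.
(* Column operation that clears the first row with the pivot [c]. *)
pose B : 'M_n.+1 := block_mx 1%:M (- (c^-1 *: ursubmx N')) 0 1%:M.
have uB : B \in unitmx.
  rewrite unitmxE (_ : \det B = 1) ?unitr1 //.
  by apply: etrans (det_ublock (1%:M : 'M_1) _ (1%:M : 'M_n)) _; rewrite !det1 mul1r.
have NB : N *m B = block_mx (c%:M : 'M_1) 0 0 (drsubmx N').
  rewrite NE; apply: etrans (mulmx_block (c%:M : 'M_1) (ursubmx N') 0 (drsubmx N')
    (1%:M : 'M_1) (- (c^-1 *: ursubmx N')) 0 1%:M) _.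
  rewrite !mulmx0 !mul0mx !mulmx1 !addr0 !add0r; congr block_mx.
  by rewrite mulmxN mul_scalar_mx scalerA mulfV // scale1r addNr.
have rkN : \rank M = (\rank (drsubmx N')).+1.
  rewrite -(rank_mul_unit M uS0' uT0) -ND -[N]mulmx1 -(mulmxV uB) mulmxA.
  rewrite mxrankMfree ?row_free_unit ?unitmx_inv // NB.
  apply: etrans (rank_diag_block_mx (c%:M : 'M_1) (drsubmx N')) _.
  by rewrite mxrank_unit // unitmxE det_scalar1 unitfE.
have [S [R [uS uR SNR]]] := normal_form_pid (drsubmx N').
pose D1 : 'M_m.+1 := block_mx (1%:M : 'M_1) 0 0 S.
pose D2 : 'M_n.+1 := block_mx (1%:M : 'M_1) 0 0 R.
have uD1 : D1 \in unitmx.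
  by have := block_diag_mx_unit (1%:M : 'M[K]_1) S; rewrite unitmx1 uS.
have uD2 : D2 \in unitmx.
  by have := block_diag_mx_unit (1%:M : 'M[K]_1) R; rewrite unitmx1 uR.
exists (D1 *m invmx S0), (T0 *m (B *m D2)).
split; first by rewrite unitmx_mul uD1.
- by rewrite !unitmx_mul uT0 uB.
- by rewrite -T0a -!mulmxA !block_fix_first.
move=> i j; have -> : D1 *m invmx S0 *m M *m (T0 *m (B *m D2)) = D1 *m (N *m B) *m D2.
  by rewrite ND !mulmxA.
have -> : D1 *m (N *m B) *m D2 = block_mx (c%:M : 'M_1) 0 0 (pid_mx (\rank M).-1).
  rewrite NB (_ : D1 *m (block_mx (c%:M : 'M_1) 0 0 (drsubmx N') : 'M_(m.+1, n.+1)) = block_mx (c%:M : 'M_1) 0 0 (S *m drsubmx N')); last first.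
    apply: etrans (mulmx_block (1%:M : 'M_1) 0 0 S (c%:M : 'M_1) 0 0 (drsubmx N')) _.
    by rewrite !mulmx0 !mul0mx !mul1mx !addr0 !add0r.
  apply: etrans (mulmx_block (c%:M : 'M_1) 0 0 (S *m drsubmx N') (1%:M : 'M_1) 0 0 R) _.
  by rewrite !mulmx0 !mul0mx !mulmx1 !addr0 !add0r SNR rkN.
rewrite rkN.
rewrite mxE; case: splitP => k ik; rewrite mxE; case: splitP => l jl.
- by rewrite -!val_eqE /= ik jl !mxE !ord1 mulr1.
- by rewrite -!val_eqE /= ik jl !mxE ord1 mulr0.
- by rewrite -!val_eqE /= ik jl !mxE ord1.
by rewrite -val_eqE /= ik jl mxE !add1n eqSS ltnS.
Qed.

End MatrixNormalForms.

(** * Choosing [S] and [T], and transfer of the three cases *)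

Section Assembly.
Variable K : fieldType.

(** The conclusion of the theorem for given [H] and [r], with the condition S = T^-1 imposed when
    the sizes agree. *)
Definition classified (m n : nat) (H : 'cV[{mpoly K[n]}]_m) (r : nat) : Prop :=
  exists (S : 'M[K]_m) (T : 'M[K]_n),
    [/\ S \in unitmx,
        T \in unitmx,
        forall e : m = n, castmx (e, e) S = invmx T
      & let Ht := linear_change S T H in
        let J := mpoly_jacobian Ht in
        [\/ forall i : 'I_m, (r <= i)%N -> row i J = 0,
            r = 2%N /\ (forall j : 'I_n, (2 <= j)%N -> col j J = 0)
          | r = 2%N /\ span_x3_quadrics Ht]].

(** For distinct sizes the compatibility condition is vacuous and the identity serves. *)
Lemma complete_T m n (S : 'M[K]_m) : S \in unitmx ->
  exists2 T : 'M[K]_n, T \in unitmx & forall e : m = n, castmx (e, e) S = invmx T.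
Proof.
move=> uS; have [e|ne] := eqVneq m n; last first.
  by exists 1%:M => [|e]; [exact: unitmx1 | rewrite e eqxx in ne].
exists (invmx (castmx (e, e) S)).
  by rewrite unitmx_inv; case: n / e; rewrite castmx_id.
by move=> e'; rewrite invmxK (eq_irrelevance e e').
Qed.

Lemma complete_S m n (T : 'M[K]_n) : T \in unitmx ->
  exists2 S : 'M[K]_m, S \in unitmx & forall e : m = n, castmx (e, e) S = invmx T.
Proof.
move=> uT; have [e|ne] := eqVneq m n; last first.
  by exists 1%:M => [|e]; [exact: unitmx1 | rewrite e eqxx in ne].
case: n / e T uT => T uT; exists (invmx T); first by rewrite unitmx_inv.
by move=> e; rewrite (eq_irrelevance e erefl) castmx_id.
Qed.

Section Finish.
Variables (m n r : nat) (H : 'cV[{mpoly K[n]}]_m) (S : 'M[K]_m) (T : 'M[K]_n).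
Hypotheses (uS : S \in unitmx) (uT : T \in unitmx).
Let H' := linear_change S T H.

Lemma linear_change_S S' : linear_change S' T H = linear_change (S' *m invmx S) 1%:M H'.
Proof. by rewrite /H' (linear_change_mul S T (S' *m invmx S) 1%:M H) mulmxKV ?mulmx1. Qed.

Lemma linear_change_T T' : linear_change S T' H = linear_change 1%:M (invmx T *m T') H'.
Proof. by rewrite /H' (linear_change_mul S T 1%:M (invmx T *m T') H) mul1mx mulKVmx. Qed.

(** Vanishing of components survives any substitution, so [T] can be replaced by the partner of
    [S]. *)
Lemma classified_rows :
  (forall i : 'I_m, (r <= i)%N -> H' i 0 = 0) -> classified H r.
Proof.
move=> H0; have [T' uT' eT'] := complete_T n uS.
exists S, T'; split=> //; constructor 1 => i ri.
have E : linear_change S T' H i 0 = 0.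
  rewrite linear_change_T linear_changeE big1 // => k _; rewrite mxE.
  have [<-|_] := eqVneq i k; first by rewrite H0 // /subst rmorph0 mulr0.
  by rewrite mpolyC0 mul0r.
by apply/rowP => j; rewrite [LHS]mxE [LHS]mxE E mderiv0 [RHS]mxE.
Qed.

(** Independence of a variable passes to linear combinations of components, so [S] can be replaced
    by the partner of [T]. *)
Lemma classified_cols : r = 2%N ->
  (forall i (j : 'I_n), (2 <= j)%N -> (H' i 0)^`M(j) = 0) -> classified H r.
Proof.
move=> r2 H0; have [S' uS' eS'] := complete_S m uT.
exists S', T; split=> //; constructor 2; split=> // j j2; apply/colP => i.
rewrite [LHS]mxE [LHS]mxE [RHS]mxE linear_change_S linear_changeE raddf_sum.
by rewrite big1 // => k _ /=; rewrite mderiv_mulC subst1 H0 ?mulr0.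
Qed.

End Finish.

Section Spans.
Variables (V : lmodType K).

Lemma in_span_trans k l (v : 'I_k -> V) (w : 'I_l -> V) p :
  (forall i, in_span w (v i)) -> in_span v p -> in_span w p.
Proof.
move=> vw [c ->]; have [d dE] : exists d : 'I_k -> 'I_l -> K,
    forall i, v i = \sum_(j < l) d i j *: w j.
  by have [d hd] := fin_all_exists vw; exists d.
exists (fun j => \sum_i c i * d i j).
under eq_bigr => i _ do rewrite dE scaler_sumr.
rewrite exchange_big; apply: eq_bigr => j _; rewrite scaler_suml.
by apply: eq_bigr => i _; rewrite scalerA.
Qed.

Lemma in_span_gen k (v : 'I_k -> V) i : in_span v (v i).
Proof.
exists (fun j => (j == i)%:R); rewrite (bigD1 i) //= eqxx scale1r big1 ?addr0 //.
by move=> j /negPf ->; rewrite scale0r.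
Qed.

Lemma in_spanZ k (v : 'I_k -> V) a p : in_span v p -> in_span v (a *: p).
Proof.
move=> [c ->]; exists (fun i => a * c i).
by rewrite scaler_sumr; apply: eq_bigr => i _; rewrite scalerA.
Qed.

Lemma in_spanD k (v : 'I_k -> V) p q :
  in_span v p -> in_span v q -> in_span v (p + q).
Proof.
move=> [c ->] [d ->]; exists (fun i => c i + d i).
by rewrite -big_split; apply: eq_bigr => i _; rewrite scalerDl.
Qed.

End Spans.

Lemma in_span_linear_change m n (S : 'M[K]_m) (H : 'cV[{mpoly K[n]}]_m) i :
  in_span (fun k => H k 0) (linear_change S 1%:M H i 0).
Proof.
exists (S i); rewrite linear_changeE; apply: eq_bigr => k _.
by rewrite subst1 mul_mpolyC.
Qed.

Lemma linear_change1 m n (T : 'M[K]_n) (H : 'cV[{mpoly K[n]}]_m) k :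
  linear_change 1%:M T H k 0 = subst T (H k 0).
Proof.
rewrite linear_changeE (bigD1 k) //= big1 ?addr0.
  by rewrite mxE eqxx mpolyC1 mul1r.
by move=> l /negPf ne_l; rewrite mxE eq_sym ne_l mpolyC0 mul0r.
Qed.

Lemma span_x3_linear_change m n (S : 'M[K]_m) (H : 'cV[{mpoly K[n]}]_m) :
  S \in unitmx -> span_x3_quadrics H -> span_x3_quadrics (linear_change S 1%:M H).
Proof.
move=> uS [i1 [i2 [i3 [ei [li sp]]]]]; exists i1, i2, i3; split=> //; split=> // p.
rewrite -(sp p); split; apply: in_span_trans => i; first exact: in_span_linear_change.
suff {2}<- : linear_change (invmx S) 1%:M (linear_change S 1%:M H) = H.
  exact: in_span_linear_change.
rewrite linear_change_mul mulVmx ?mulmx1 //; apply/colP => k.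
by rewrite linear_change1 subst1.
Qed.

(** Case (3) concerns only the span of the components, which any invertible [S] preserves. *)
Lemma classified_span m n r (H : 'cV[{mpoly K[n]}]_m) S T T2 :
    S \in unitmx -> T \in unitmx -> T2 \in unitmx -> r = 2%N ->
  span_x3_quadrics (linear_change 1%:M T2 (linear_change S T H)) -> classified H r.
Proof.
move=> uS uT uT2 r2 sp.
have uTT : T *m T2 \in unitmx by rewrite unitmx_mul uT.
have [S' uS' eS'] := complete_S m uTT.
exists S', (T *m T2); split; [exact: uS' | exact: uTT | exact: eS' | constructor 3].
split; first exact: r2.
move: sp; rewrite linear_change_mul mul1mx => sp; rewrite (linear_change_S _ _ uS).
by apply: span_x3_linear_change sp; rewrite unitmx_mul uS' unitmx_inv.
Qed.

End Assembly.

(** * Leading coefficients read off from the gradient at a unit vector *)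

Section LeadingForms.
Variables (K : fieldType) (n : nat) (i : 'I_n) (p : {mpoly K[n]}).
Hypotheses (nz3 : 3%:R != 0 :> K) (hp : p \is 3.-homog).
Let d j := p^`M(j).@[unit_point K i].

Definition cubic_form (h : K) (l : {mpoly K[n]}) := exists q c,
  [/\ p = cubic_in i h l q c, q \is 2.-homog, c \is 3.-homog,
      free_of i q & free_of i c].

Lemma cubic_form0 : (forall j, d j = 0) -> cubic_form 0 0.
Proof.
move=> d0; have [q [c [e hq hc fq fc]]] := cubic_at_point i nz3 hp.
exists q, c; split=> //; rewrite [LHS]e -/(d i) d0 mul0r big1 // => j _.
by rewrite -/(d j) d0 mpolyC0 mul0r.
Qed.

Lemma cubic_formX j : j != i -> (forall k, d k = (k == j)%:R) -> cubic_form 0 'X_j.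
Proof.
move=> ne_j dE; have [q [c [e hq hc fq fc]]] := cubic_at_point i nz3 hp.
exists q, c; split=> //; rewrite [LHS]e -/(d i) dE eq_sym (negPf ne_j) mul0r.
congr cubic_in; rewrite (bigD1 j) //= -/(d j) dE eqxx mpolyC1 mul1r big1 ?addr0 //.
by move=> k /andP[_ /negPf ne_k]; rewrite -/(d k) dE ne_k mpolyC0 mul0r.
Qed.

Lemma cubic_form1 : (forall j, d j = 3%:R * (j == i)%:R) -> cubic_form 1 0.
Proof.
move=> dE; have [q [c [e hq hc fq fc]]] := cubic_at_point i nz3 hp.
exists q, c; split=> //; rewrite [LHS]e -/(d i) dE eqxx mulr1 mulfV //.
congr cubic_in; rewrite big1 // => k /negPf ne_k.
by rewrite -/(d k) dE ne_k mulr0 mpolyC0 mul0r.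
Qed.

End LeadingForms.

(** * Rank two with a component whose leading term is a cube *)

Section RankTwoCore.
Variables (K : fieldType) (m n : nat) (i j : 'I_n).
Hypotheses (nz2 : 2%:R != 0 :> K) (nz3 : 3%:R != 0 :> K).
Hypotheses (i0 : i = 0%N :> nat) (j1 : j = 1%N :> nat).
Local Notation A := {mpoly K[n]}.
Local Notation X := ('X_i : A).
Local Notation Y := ('X_j : A).
Variables (F : 'cV[A]_m) (k0 k1 : 'I_m).
Hypothesis hF : cubic_homogeneous F.
Hypothesis JF : forall a b c u v w, jac3 (F a 0) (F b 0) (F c 0) u v w = 0.
Hypotheses (F0 : cubic_form i (F k0 0) 1 0) (F1 : cubic_form i (F k1 0) 0 Y).
Hypothesis Fk : forall k, k != k0 -> k != k1 -> cubic_form i (F k 0) 0 0.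

(** Since [l] involves a further variable, [p], [Y], [g] are independent and can be made the first
    three coordinates. The components then span x3 x1^2, x3 x1 x2 and x3 x2^2, the last supplied by
    [k2]. *)
Lemma conic_span l (a b : K) (k2 : 'I_m) (c : 'I_m -> K) :
    l \is 1.-homog -> free_of i l ->
    (exists2 v, v != i /\ v != j & l^`M(v) != 0) ->
    let p := X - l in let g := X + 2%:R * l in
    F k0 0 + a%:MP * (Y ^+ 2 * g) = p ^+ 2 * g ->
    F k1 0 + b%:MP * (Y ^+ 2 * g) = Y * p * g ->
    (forall k, k != k0 -> k != k1 -> F k 0 = (c k)%:MP * (Y ^+ 2 * g)) ->
    k2 != k0 -> k2 != k1 -> c k2 != 0 ->
  exists2 T : 'M[K]_n, T \in unitmx & span_x3_quadrics (linear_change 1%:M T F).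
Proof.
move=> hl fl [v0 [v0_i v0_j] lv0] p g e0 e1 ek ne20 ne21 c2.
have [lc [lE dl]] := linear_formP hl.
have lci : lc i = 0 by apply/eqP; rewrite -(mpolyC_eq0 n) -dl free_of_deriv0.
rewrite dl mpolyC_eq0 in lv0.
have ne_j : j != i by rewrite -val_eqE /= i0 j1.
have n3 : (2 < n)%N.
  apply: leq_ltn_trans (ltn_ord v0); move: v0_i v0_j; rewrite -!val_eqE /= i0 j1.
  by case: (v0 : nat) => [|[|]].
pose k3 : 'I_n := Ordinal n3; pose x3 : A := 'X_k3.
(* The rows are the coefficient vectors of [p], [Y] and [g]. *)
pose C : 'M[K]_(3, n) := \matrix_(r, v)
  nth 0 [:: (v == i)%:R - lc v; (v == j)%:R; (v == i)%:R + 2%:R * lc v] r.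
pose r0 := @Ordinal 3 0 isT; pose r1 := @Ordinal 3 1 isT; pose r2 := @Ordinal 3 2 isT.
have CE (r : 'I_3) : \sum_v (row r C 0 v)%:MP * 'X_v = nth 0 [:: p; Y; g] r.
  have XE w : \sum_v ((v == w)%:R)%:MP * 'X_v = 'X_w :> A.
    rewrite (bigD1 w) //= eqxx mpolyC1 mul1r big1 ?addr0 // => v /negPf ->.
    by rewrite mpolyC0 mul0r.
  case: r => [[|[|[|r]]] hr] //=.
  - rewrite /p -[X in X - _]XE lE -sumrB; apply: eq_bigr => v _.
    by rewrite !mxE /= mpolyCB mulrBl.
  - by rewrite -[RHS]XE; apply: eq_bigr => v _; rewrite !mxE.
  rewrite /g -[X in X + _]XE lE mulr_sumr -big_split; apply: eq_bigr => v _.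
  by rewrite !mxE /= mpolyCD mpolyCM !rmorph_nat; ring.
have freeC : row_free C.
  rewrite /row_free eqn_leq rank_leq_row.
  apply/rank_minor; exists (tnth [tuple r0; r1; r2]), (tnth [tuple i; j; v0]).
  rewrite det_mxsub3 !mxE /= !eqxx lci (negPf v0_i) (negPf v0_j) (negPf ne_j).
  rewrite [i == j]eq_sym (negPf ne_j) /=.
  (* The minor in columns i, j, v0 is 3 times the coefficient of ['X_v0] in [l]. *)
  have -> : forall x y : K, (1 - 0) * (1 * (0 + 2%:R * x) - 0 * (0 + 2%:R * y))
     - (0 - y) * (0 * (0 + 2%:R * x) - 0 * (1 + 2%:R * 0))
     + (0 - x) * (0 * (0 + 2%:R * y) - 1 * (1 + 2%:R * 0)) = 3%:R * x by move=> x y; ring.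
  by rewrite mulf_neq0.
have [T' uT' CT'] := row_free_complete freeC.
pose T := invmx T'; have CT : C *m T = pid_mx 3 by rewrite CT' mulmxK.
have uT : T \in unitmx by rewrite unitmx_inv.
have formT (r : 'I_3) (w : 'I_n) : w = r :> nat -> subst T (nth 0 [:: p; Y; g] r) = 'X_w.
  move=> wr; rewrite -CE subst_linear_form -row_mul CT (bigD1 w) //= big1 ?addr0.
    by rewrite !mxE wr eqxx ltn_ord mpolyC1 mul1r.
  move=> v; rewrite -val_eqE /= wr !mxE eq_sym => /negPf ->.
  by rewrite mpolyC0 mul0r.
have pT : subst T p = X by apply: (formT r0).
have YT : subst T Y = Y by apply: (formT r1).
have gT : subst T g = x3 by apply: (formT r2).
exists T => //; exists i, j, k3; split; first by split.
pose b3 := tnth [tuple x3 * X ^+ 2; x3 * X * Y; x3 * Y ^+ 2].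
change (lin_indep b3 /\ forall P, in_span (fun k => linear_change 1%:M T F k 0) P
  <-> in_span b3 P).
have u2 k : k != k0 -> k != k1 -> subst T (F k 0) = c k *: (x3 * Y ^+ 2).
  move=> ne0 ne1; rewrite ek // !(substM, substXn) substC.
  by rewrite YT gT -mul_mpolyC; ring.
have u0 : subst T (F k0 0) = x3 * X ^+ 2 + (- a) *: (x3 * Y ^+ 2).
  rewrite -(addrK (a%:MP * (Y ^+ 2 * g)) (F k0 0)) e0.
  rewrite substB !(substM, substXn) substC pT YT gT.
  by rewrite -mul_mpolyC mpolyCN; ring.
have u1 : subst T (F k1 0) = x3 * X * Y + (- b) *: (x3 * Y ^+ 2).
  rewrite -(addrK (b%:MP * (Y ^+ 2 * g)) (F k1 0)) e1.
  rewrite substB !(substM, substXn) substC pT YT gT.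
  by rewrite -mul_mpolyC mpolyCN; ring.
have g0 : in_span b3 (x3 * X ^+ 2) by have := in_span_gen b3 r0.
have g1 : in_span b3 (x3 * X * Y) by have := in_span_gen b3 r1.
have g2 : in_span b3 (x3 * Y ^+ 2) by have := in_span_gen b3 r2.
split.
  move=> d; rewrite !big_ord_recl big_ord0 addr0 /b3 !(tnth_nth 0) /= => d0.
  (* At x1 = s, x2 = t, x3 = 1 the relation becomes a binary quadratic form; (1, 0), (0, 1) and (1,
     1) determine its coefficients. *)
  pose pt (s t : K) (v : 'I_n) := if v == i then s else if v == j then t else 1.
  have ev s t : d r0 * s ^+ 2 + d r1 * (s * t) + d r2 * t ^+ 2 = 0.
    have := congr1 (meval (pt s t)) d0; rewrite meval0 /x3.
    rewrite !expr2 !(mevalD, mevalZ, mevalM) !mevalXU /pt !eqxx (negPf ne_j).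
    rewrite -!val_eqE /= i0 j1 /=.
    have -> : lift ord0 ord0 = r1 by apply/val_inj.
    have -> : lift ord0 (lift ord0 ord0) = r2 by apply/val_inj.
    have -> : ord0 = r0 by apply/val_inj.
    by move=> e; rewrite -[RHS]e; ring.
  have d_0 : d r0 = 0 by have := ev 1 0; rewrite mulr0 expr1n expr0n !mulr0 mulr1 !addr0.
  have d_2 : d r2 = 0 by have := ev 0 1; rewrite mul0r expr1n expr0n !mulr0 mulr1 !add0r.
  have d_1 : d r1 = 0.
    by have := ev 1 1; rewrite d_0 d_2 !mul0r add0r addr0 !mulr1.
  by case=> [[|[|[|r]]] hr] //; [rewrite -[RHS]d_0 | rewrite -[RHS]d_1 | rewrite -[RHS]d_2];
    congr d; apply/val_inj.
move=> P; split; apply: in_span_trans.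
  move=> k; rewrite linear_change1.
  have [->|ne0] := eqVneq k k0; first by rewrite u0; apply/in_spanD/in_spanZ.
  have [->|ne1] := eqVneq k k1; first by rewrite u1; apply/in_spanD/in_spanZ.
  by rewrite u2 //; apply: in_spanZ.
pose w k := linear_change 1%:M T F k 0.
have wE k : w k = subst T (F k 0) by rewrite /w linear_change1.
have s2 : in_span w (x3 * Y ^+ 2).
  have := in_spanZ (c k2)^-1 (in_span_gen w k2).
  by rewrite wE u2 // scalerA mulVf // scale1r.
have s0 : in_span w (x3 * X ^+ 2).
  have := in_spanD (in_span_gen w k0) (in_spanZ a s2).
  by rewrite wE u0 scaleNr subrK.
have s1 : in_span w (x3 * X * Y).
  have := in_spanD (in_span_gen w k1) (in_spanZ b s2).
  by rewrite wE u1 scaleNr subrK.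
by case=> [[|[|[|r]]] hr] //; rewrite /b3 (tnth_nth 0).
Qed.

(** Each remaining component is given by a pair (a_k, b_k). If all pairs are zero, these components
    vanish; if Y^3 lies in their span, only X and Y occur; otherwise the pairs are proportional and
    [contracted_cases] applies. *)
Lemma rank_two_core :
  [\/ forall k, k != k0 -> k != k1 -> F k 0 = 0,
      forall k (v : 'I_n), (2 <= v)%N -> (F k 0)^`M(v) = 0
    | exists2 T : 'M[K]_n, T \in unitmx & span_x3_quadrics (linear_change 1%:M T F)].
Proof.
have ne_j : j != i by rewrite -val_eqE /= i0 j1.
have neE (v : 'I_n) : (2 <= v)%N -> v != i /\ v != j.
  by rewrite -!val_eqE /= i0 j1 => v2; split; apply: contraTneq v2 => ->.
have [q1 [c1 [f1E hq1 hc1 fq1 fc1]]] := F0.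
have [q2 [c2 [f2E hq2 hc2 fq2 fc2]]] := F1.
have con k : contracted (F k0 0) (F k1 0) (F k 0) by apply: euler_jac3.
have row k : k != k0 -> k != k1 -> exists ab : K * K,
    F k 0 = cubic_in i 0 0 (ab.1%:MP * Y ^+ 2)
              ((2%:R * ab.1)%:MP * Y * q2 + ab.2%:MP * Y ^+ 3).
  move=> ne0 ne1; have [q [c [fE hq hc fq fc]]] := Fk ne0 ne1.
  have := con k; rewrite fE f1E f2E => /(contracted_third_row nz2 nz3 ne_j).
  by move=> [] // a [b [-> ->]]; exists (a, b).
have [ab abE] : exists ab : 'I_m -> K * K, forall k, k != k0 -> k != k1 ->
    F k 0 = cubic_in i 0 0 ((ab k).1%:MP * Y ^+ 2)
              ((2%:R * (ab k).1)%:MP * Y * q2 + (ab k).2%:MP * Y ^+ 3).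
  have ex k : exists ab : K * K, k != k0 -> k != k1 ->
    F k 0 = cubic_in i 0 0 (ab.1%:MP * Y ^+ 2)
              ((2%:R * ab.1)%:MP * Y * q2 + ab.2%:MP * Y ^+ 3).
    (* The pair at [k0] and [k1] is a dummy value, excluded by the guards. *)
    have [|ne0] := eqVneq k k0; first by exists 0.
    have [|ne1] := eqVneq k k1; first by exists 0.
    by have [ab abE] := row k ne0 ne1; exists ab.
  by have [ab h] := fin_all_exists ex; exists ab.
have cube_case (g : A) (b : K) : b != 0 -> g = b%:MP * Y ^+ 3 ->
    (forall v, jac3 (F k0 0) (F k1 0) g i j v = 0) ->
    forall k (v : 'I_n), (2 <= v)%N -> (F k 0)^`M(v) = 0.
  move=> b0 gE J k v v2; have [v_i v_j] := neE v v2.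
  have dY w : w != j -> Y^`M(w) = 0.
    by move=> /negPf ne_w; rewrite mderivXU eq_sym ne_w.
  have dYj : Y^`M(j) = 1 by rewrite mderivXU eqxx.
  (* As dg = 3 b Y^2 dY, the minor at (i, j, v) is, up to sign, 3 b Y^2 times this one. *)
  have J2 : jac2 (F k0 0) (F k1 0) i v = 0.
    have z : 3%:R%:MP * b%:MP * Y ^+ 2 != 0 :> A.
      by rewrite !mulf_neq0 ?mpolyC_eq0 ?mpolyX_neq0.
    apply: (mulfI z); rewrite mulr0 -[RHS]oppr0 -[X in _ = - X](J v) /jac3 /jac2 gE.
    rewrite !exprS expr0 !(mderiv_mulC, mderivM, mderiv1) (dY i) 1?eq_sym //.
    by rewrite (dY v) // dYj rmorph_nat; ring.
  move: J2; rewrite f1E f2E => J2.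
  have [d0 d1 d2] := jac2_other_derivs nz2 nz3 ne_j fq1 fc1 fq2 fc2 v_i v_j J2.
  have [->|ne0] := eqVneq k k0; first by rewrite f1E.
  have [->|ne1] := eqVneq k k1; first by rewrite f2E.
  rewrite abE // mderiv_cubic_in // !exprS expr0 !mderivE dY // d2 /cubic_in mpolyC0.
  by ring.
have [/existsP[k2 /and3P[ne20 ne21 a2]]|/existsPn a_eq0] :=
    boolP [exists k, [&& k != k0, k != k1 & (ab k).1 != 0]]; last first.
  have a0 k : k != k0 -> k != k1 -> (ab k).1 = 0.
    by move=> ne0 ne1; have := a_eq0 k; rewrite ne0 ne1 /= negbK => /eqP.
  have [/existsP[k3 /and3P[ne30 ne31 b3]]|/existsPn b_eq0] :=
      boolP [exists k, [&& k != k0, k != k1 & (ab k).2 != 0]].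
    constructor 2; apply: (cube_case (F k3 0) _ b3) => [|v]; last exact: JF.
    by rewrite abE // a0 // /cubic_in mulr0 mpolyC0; ring.
  constructor 1 => k ne0 ne1; have := b_eq0 k; rewrite ne0 ne1 /= negbK => /eqP b0.
  by rewrite abE // a0 // b0 /cubic_in mulr0 mpolyC0; ring.
(* The determinant of the pairs at [k2] and [k]: eliminating the a-part from the two components
   leaves D Y^3. *)
pose D k := (ab k2).1 * (ab k).2 - (ab k).1 * (ab k2).2.
have [/existsP[k3 /and3P[ne30 ne31 b3]]|/existsPn D_eq0] :=
    boolP [exists k, [&& k != k0, k != k1 & D k != 0]].
  constructor 2.
  pose g := (ab k2).1%:MP * F k3 0 - (ab k3).1%:MP * F k2 0.
  apply: (cube_case g _ b3) => [|v].
    by rewrite /g abE // abE // /cubic_in /D mpolyCB !mpolyCM mpolyC0; ring.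
  transitivity ((ab k2).1%:MP * jac3 (F k0 0) (F k1 0) (F k3 0) i j v
                - (ab k3).1%:MP * jac3 (F k0 0) (F k1 0) (F k2 0) i j v).
    by rewrite /jac3 /jac2 /g !(mderivB, mderiv_mulC); ring.
  by rewrite !JF !mulr0 subr0.
have D0 k : k != k0 -> k != k1 -> D k = 0.
  by move=> ne0 ne1; have := D_eq0 k; rewrite ne0 ne1 /= negbK => /eqP.
(* All pairs are now multiples of (1, s), so each remaining component is a_k g. *)
pose s := (ab k2).2 / (ab k2).1.
pose g := cubic_in i 0 0 (Y ^+ 2) (2%:R * Y * q2 + s%:MP * Y ^+ 3).
have Fg k : k != k0 -> k != k1 -> F k 0 = (ab k).1%:MP * g.
  move=> ne0 ne1; rewrite abE // /g /cubic_in.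
  have -> : (ab k).2 = (ab k).1 * s.
    apply: (mulfI a2); rewrite [RHS]mulrCA [_ * s]mulrC /s divfK //.
    by apply/eqP; rewrite -subr_eq0 -/(D k) D0.
  by rewrite !mpolyCM mpolyC0 rmorph_nat; ring.
have gF : g = ((ab k2).1^-1)%:MP * F k2 0.
  by rewrite Fg // mulrA -mpolyCM mulVf // mpolyC1 mul1r.
have con_g : contracted (F k0 0) (F k1 0) g.
  move=> v w; rewrite -[RHS](mulr0 ((ab k2).1^-1)%:MP) -[X in _ = _ * X](con k2 v w) gF.
  by rewrite /jac2 !mderiv_mulC; ring.
move: con_g; rewrite f1E f2E.
case/(contracted_cases nz2 nz3 ne_j hq1 hc1 hq2 hc2 fq1 fc1 fq2 fc2) => [dF|].
  constructor 2 => k v v2; have [v_i v_j] := neE v v2; have [d0 d1 dg] := dF v v_i v_j.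
  have [->|ne0] := eqVneq k k0; first by rewrite f1E.
  have [->|ne1] := eqVneq k k1; first by rewrite f2E.
  by rewrite Fg // mderiv_mulC dg mulr0.
move=> [l [a [b [[hl fl lv] []]]]]; rewrite -f1E -f2E -/g => e0 e1 gE.
constructor 3; apply: (conic_span hl fl lv (a := a) (b := b) _ _ _ ne20 ne21 a2).
- by rewrite -gE.
- by rewrite -gE.
- by move=> k ne0 ne1; rewrite -gE Fg.
Qed.

End RankTwoCore.

(** * The two cases H(a) = 0 and H(a) nonzero, and the theorem *)

Section Classification.
Variables (K : fieldType) (m n r : nat) (H : 'cV[{mpoly K[n.+1]}]_m.+1).
Variable a : 'cV[K]_n.+1.
Hypotheses (nz2 : 2%:R != 0 :> K) (nz3 : 3%:R != 0 :> K).
Hypotheses (hH : cubic_homogeneous H) (rE : r = mpoly_rank (mpoly_jacobian H)).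
Hypotheses (r12 : (1 <= r <= 2)%N) (a0 : a != 0) (rk_a : \rank (jacobian_at H a) = r).

Lemma deriv_unit_point S T k j : T *m delta_mx 0 0 = a ->
  ((linear_change S T H k 0)^`M(j)).@[unit_point K 0]
  = (S *m jacobian_at H a *m T) k j.
Proof.
move=> <-; rewrite -jacobian_at_linear_change [RHS]mxE [_ k j]mxE.
by apply: meval_eq => l; rewrite mxE eqxx andbT.
Qed.

Lemma linear_change_ratio S T k l : (r <= 1)%N ->
  let F := linear_change S T H in
  forall v, F k 0 * (F l 0)^`M(v) - F l 0 * (F k 0)^`M(v) = 0.
Proof.
move=> r1 F; have hF := linear_change_homog S T hH.
apply: euler_jac2 => //; apply: rank_jacobian_jac2.
by apply: leq_trans (rank_jacobian_linear_change S T H) _; rewrite -rE.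
Qed.

Lemma linear_change_jac3 S T k l s u v w :
  let F := linear_change S T H in jac3 (F k 0) (F l 0) (F s 0) u v w = 0.
Proof.
apply: rank_jacobian_jac3; apply: leq_trans (rank_jacobian_linear_change S T H) _.
by rewrite -rE; case/andP: r12.
Qed.

(** The first [r] components start with X^2 times distinct further variables, the others have no
    terms in X^3 or X^2; comparison of coefficients makes the latter zero. *)
Lemma classified_kernel : jacobian_at H a *m a = 0 -> classified H r.
Proof.
move=> Ja; have [S [T [uS uT Ta ST]]] := normal_form_kernel a0 Ja.
rewrite rk_a in ST; pose F := linear_change S T H.
have hF : cubic_homogeneous F by apply: linear_change_homog.
have lead k j : ((F k 0)^`M(j)).@[unit_point K 0] = ((k.+1 == j :> nat) && (k < r)%N)%:R.
  by rewrite deriv_unit_point.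
(* There are n + 1 variables; full column rank would force a = 0. *)
have r_n : (r <= n)%N.
  rewrite leqNgt; apply: contra_neqN a0 => n_r.
  have /row_fullP[B BJ] : row_full (jacobian_at H a).
    by rewrite /row_full eqn_leq rank_leq_col rk_a.
  by rewrite -[LHS]mul1mx -BJ -mulmxA Ja mulmx0.
have r_m : (r <= m.+1)%N by rewrite -rk_a rank_leq_row.
apply: (classified_rows uS uT) => k rk; rewrite -/F.
have [q [c [gE hq hc fq fc]]] : cubic_form 0 (F k 0) 0 0.
  by apply: cubic_form0 => // j; rewrite lead ltnNge rk andbF.
have low s (s_r : (s < r)%N) : exists j : 'I_n.+1, j = s.+1 :> nat /\
    exists2 k0 : 'I_m.+1, k0 = s :> nat & cubic_form 0 (F k0 0) 0 'X_j.
  have s_n : (s.+1 < n.+1)%N by rewrite ltnS (leq_trans s_r).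
  exists (Ordinal s_n); split=> //; exists (Ordinal (leq_trans s_r r_m)) => //.
  by apply: cubic_formX => // j; rewrite lead /= s_r andbT eq_sym.
have r0 : (0 < r)%N by case/andP: r12.
have [j [j1 [k0 k00 [q1 [c1 [f1E hq1 hc1 fq1 fc1]]]]]] := low 0 r0.
have ne_j : j != 0 by rewrite -val_eqE /= j1.
have [r1|r2] := leqP r 1.
  have rat v := linear_change_ratio S T k0 k r1 v; rewrite -/F f1E gE in rat.
  rewrite gE; apply: (ratio_no_lead nz2 _ _ _ _ _ _ _ rat ne_j) => //.
  exact: free_ofX.
have [j' [j2 [k1 k11 [q2 [c2 [f2E hq2 hc2 fq2 fc2]]]]]] := low 1 r2.
have ne_j' : j' != 0 by rewrite -val_eqE /= j2.
have ne_jj' : j != j' by rewrite -val_eqE /= j1 j2.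
have con : contracted (F k0 0) (F k1 0) (F k 0).
  by apply: euler_jac3 => // u v w; apply: linear_change_jac3.
rewrite f1E f2E gE in con; rewrite gE.
exact: (contracted_no_lead nz2 ne_j ne_j' ne_jj' hq hc fq1 fc1 fq2 fc2 fq fc con).
Qed.

(** The first component starts with X^3 and, for r = 2, the second with X^2 Y. Rank one is settled
    by [ratio_lead], rank two by [rank_two_core]. *)
Lemma classified_image : jacobian_at H a *m a != 0 -> classified H r.
Proof.
rewrite jacobian_at_euler // scaler_eq0 (negPf nz3) /= => h0.
have [S [T [uS uT Ta ST]]] := normal_form_image a0 h0 nz3 (jacobian_at_euler a hH).
rewrite rk_a in ST; pose F := linear_change S T H.
have hF : cubic_homogeneous F by apply: linear_change_homog.
have lead k j : ((F k 0)^`M(j)).@[unit_point K 0] =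
    if k == 0 then 3%:R * (j == 0)%:R else ((k == j :> nat) && (k < r)%N)%:R.
  by rewrite deriv_unit_point.
have F0 : cubic_form 0 (F 0 0) 1 0 by apply: cubic_form1 => // j; rewrite lead eqxx.
have r0 : (0 < r)%N by case/andP: r12.
have Fk (k : 'I_m.+1) : (r <= k)%N -> cubic_form 0 (F k 0) 0 0.
  move=> rk; apply: cubic_form0 => // j; rewrite lead -val_eqE /=.
  by rewrite [(k < r)%N]ltnNge rk andbF; case: (val k) rk => //; rewrite leqNgt r0.
have [r1|r2] := leqP r 1.
  apply: (classified_rows uS uT) => k rk; rewrite -/F.
  have [q [c [gE hq hc fq fc]]] := Fk k rk.
  have [q1 [c1 [f1E hq1 hc1 fq1 fc1]]] := F0.
  have rat v := linear_change_ratio S T 0 k r1 v; rewrite -/F f1E gE in rat.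
  by rewrite gE; apply: (ratio_lead nz2 nz3 _ _ _ _ _ _ _ rat) => //; apply: free_of0.
have r_2 : r = 2%N by apply/eqP; rewrite eqn_leq r2; case/andP: r12 => _ ->.
have m1 : (1 < m.+1)%N by rewrite -r_2 -rk_a rank_leq_row.
have n1 : (1 < n.+1)%N by rewrite -r_2 -rk_a rank_leq_col.
pose k1 : 'I_m.+1 := Ordinal m1; pose j : 'I_n.+1 := Ordinal n1.
have ne_k : k1 != 0 by [].
have F1 : cubic_form 0 (F k1 0) 0 'X_j.
  apply: cubic_formX => // l; rewrite lead (negPf ne_k) r_2 andbT.
  by rewrite -val_eqE eq_sym.
have k2 (k : 'I_m.+1) : k != 0 -> k != k1 -> (2 <= k)%N.
  by rewrite -!val_eqE /=; case: (val k) => [|[|]].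
have Fk' (k : 'I_m.+1) : k != 0 -> k != k1 -> cubic_form 0 (F k 0) 0 0.
  by move=> ne0 ne1; apply: Fk; rewrite r_2 k2.
have [F_0|dF|[T2 uT2 sp]] := rank_two_core nz2 nz3 (erefl : (0 : 'I_n.+1) = 0%N :> nat)
    (erefl : j = 1%N :> nat) hF (linear_change_jac3 S T) F0 F1 Fk'.
- apply: (classified_rows uS uT) => k; rewrite r_2 => k_2; apply: F_0.
    by apply: contraTneq k_2 => ->.
  by apply: contraTneq k_2 => ->.
- exact: (classified_cols uS uT r_2 dF).
exact: (classified_span uS uT uT2 r_2 sp).
Qed.

End Classification.

Theorem theorem2p4 (K : fieldType) (m n : nat) (H : 'cV[{mpoly K[n]}]_m)
    (r : nat) :
  (0 < m)%N -> (0 < n)%N ->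
  2%N \notin [pchar K] -> 3%N \notin [pchar K] ->
  cubic_homogeneous H ->
  r = mpoly_rank (mpoly_jacobian H) ->
  (1 <= r <= 2)%N ->
  exists (S : 'M[K]_m) (T : 'M[K]_n),
    [/\ S \in unitmx,
        T \in unitmx,
        forall e : m = n, castmx (e, e) S = invmx T
      & let Ht := linear_change S T H in
        let J := mpoly_jacobian Ht in
        [\/ forall i : 'I_m, (r <= i)%N -> row i J = 0,
            r = 2%N /\ (forall j : 'I_n, (2 <= j)%N -> col j J = 0)
          | r = 2%N /\ span_x3_quadrics Ht]].
Proof.
case: m H => // m H _; case: n H => // n H _ c2 c3 hH rE r12.
have nz2 : 2%:R != 0 :> K by move: c2; rewrite inE.
have nz3 : 3%:R != 0 :> K by move: c3; rewrite inE.
have [a rk_a] := generic_rank_point c2 c3 hH rE (proj2 (andP r12)).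
(* At the origin the Jacobian is zero, whereas r is at least 1. *)
have a0 : a != 0.
  apply: contraTneq r12 => a0; rewrite a0 jacobian_at0 // mxrank0 in rk_a.
  by rewrite -rk_a.
change (classified H r); have [Ja|Ja] := eqVneq (jacobian_at H a *m a) 0.
  exact: classified_kernel Ja.
exact: classified_image Ja.
Qed.
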